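(* Whether a given instance of Solitaire Hanabi admits a winning play sequence can be decided in $O(N(h^2+hc)c^h n^{h+c-1})$ time using $O(c^h n^{h+c-1})$ space, where $N$ is the number of cards in the deck, $n$ the number of values, $c$ the number of colors and $h$ the hand size.
   Context: Solitaire Hanabi: a card is a pair $(a,k)$ with value $a\in\{1,\dots,n\}$ and color $k\in\{1,\dots,c\}$. An instance consists of the hand size $h$ and a fully known deck $\sigma$ of $N$ cards drawn one by one in order, starting with an empty hand. When a card is drawn the player may discard it (gone forever), store it in hand, or play it immediately; at no time may more than $h$ cards be stored in hand. A card $(a,k)$ may be played iff either $a=1$ and no card of color $k$ has been played, or the last card of color $k$ played has value $a-1$. After playing a card, the player may also play stored cards obeying the same rule. A winning play sequence is one that plays (one copy of) every card $(a,k)$, $1\le a\le n$, $1\le k\le c$. *)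

(* Defs.v *)
From mathcomp Require Import all_boot.
Set Implicit Arguments. Unset Strict Implicit. Unset Printing Implicit Defensive.

(* A hcard is a pair (value, color). *)
Definition hcard := (nat * nat)%type.

(* [p k] = value of the last hcard of color k played (0 = none played). *)
Definition playable (p : nat -> nat) (x : hcard) : bool :=
  (0 < x.1) && (p x.2 == x.1.-1).

Definition upd (p : nat -> nat) (x : hcard) : nat -> nat :=
  fun j => if j == x.2 then x.1 else p j.

Inductive play_stored : (nat -> nat) -> seq hcard -> (nat -> nat) -> seq hcard -> Prop :=
| ps_refl p H : play_stored p H p H
| ps_step p H1 x H2 p' H' :
    playable p x -> play_stored (upd p x) (H1 ++ H2) p' H' ->
    play_stored p (H1 ++ x :: H2) p' H'.

Inductive draw_step (h : nat) (x : hcard) :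
  (nat -> nat) -> seq hcard -> (nat -> nat) -> seq hcard -> Prop :=
| ds_discard p H : draw_step h x p H p H
| ds_store p H : size H < h -> draw_step h x p H p (x :: H)
| ds_play p H p' H' :
    playable p x -> play_stored (upd p x) H p' H' -> draw_step h x p H p' H'.

Fixpoint reachable (h : nat) (deck : seq hcard) (p : nat -> nat) (H : seq hcard)
  (p' : nat -> nat) (H' : seq hcard) : Prop :=
  match deck with
  | [::] => (forall k, p' k = p k) /\ H' = H
  | x :: d => exists p1 H1, draw_step h x p H p1 H1 /\ reachable h d p1 H1 p' H'
  end.

(* A winning play sequence exists: starting with an empty hand and nothing
   played, every hcard (a,k), 1<=a<=n, 1<=k<=c, gets played, i.e. every
   color reaches value n. *)
Definition winnable (h n c : nat) (deck : seq hcard) : Prop :=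
  exists p H, reachable h deck (fun _ => 0) [::] p H /\
              forall k, 1 <= k <= c -> p k = n.

Definition valid_deck (n c : nat) (deck : seq hcard) : bool :=
  all (fun x => (1 <= x.1 <= n) && (1 <= x.2 <= c)) deck.

(* Registers R[0], R[1], ... (a program only uses finitely many),
   a working memory M[0], M[1], ..., and a read-only input array. *)
Inductive instr :=
| IConst (r v : nat)
| IAdd (r a b : nat)
| ISub (r a b : nat)        (* R[r] := R[a] - R[b] (truncated) *)
| IMul (r a b : nat)
| IDiv (r a b : nat)        (* R[r] := R[a] %/ R[b] (x %/ 0 = 0) *)
| IMod (r a b : nat)
| ILt (r a b : nat)
| IEq (r a b : nat)
| IInLen (r : nat)
| IReadIn (r a : nat)       (* R[r] := input[R[a]] (0 if out of range) *)
| ILoad (r a : nat)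
| IStore (a b : nat)
| IJz (r t : nat)
| IJmp (t : nat)
| IHalt.

Record mstate := MSt { pc : nat; reg : nat -> nat; mem : nat -> nat }.

Definition fupd (f : nat -> nat) (i v : nat) : nat -> nat :=
  fun j => if j == i then v else f j.

Definition init_state : mstate := MSt 0 (fun _ => 0) (fun _ => 0).

Definition step (P : seq instr) (inp : seq nat) (s : mstate)
  : option (mstate * option nat) :=
  let R := reg s in
  let nx := (pc s).+1 in
  let setr r v := MSt nx (fupd R r v) (mem s) in
  if pc s < size P then
    match nth IHalt P (pc s) with
    | IConst r v => Some (setr r v, None)
    | IAdd r a b => Some (setr r (R a + R b), None)
    | ISub r a b => Some (setr r (R a - R b), None)
    | IMul r a b => Some (setr r (R a * R b), None)
    | IDiv r a b => Some (setr r (R a %/ R b), None)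
    | IMod r a b => Some (setr r (R a %% R b), None)
    | ILt r a b => Some (setr r (nat_of_bool (R a < R b)), None)
    | IEq r a b => Some (setr r (nat_of_bool (R a == R b)), None)
    | IInLen r => Some (setr r (size inp), None)
    | IReadIn r a => Some (setr r (nth 0 inp (R a)), None)
    | ILoad r a => Some (setr r (mem s (R a)), Some (R a))
    | IStore a b => Some (MSt nx R (fupd (mem s) (R a) (R b)), Some (R a))
    | IJz r t => Some (MSt (if R r == 0 then t else nx) R (mem s), None)
    | IJmp t => Some (MSt t R (mem s), None)
    | IHalt => None
    end
  else None.

Fixpoint within (P : seq instr) (inp : seq nat) (T S W : nat) (s : mstate)
  {struct T} : Prop :=
  match step P inp s with
  | None => True
  | Some (s', oa) =>
      match T with
      | 0 => False
      | T'.+1 =>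
          (forall a, oa = Some a -> a < S) /\
          (forall r, reg s' r <= W) /\ (forall i, mem s' i <= W) /\
          within P inp T' S W s'
      end
  end.

Fixpoint exec (P : seq instr) (inp : seq nat) (T : nat) (s : mstate)
  : option mstate :=
  match step P inp s with
  | None => Some s
  | Some (s', _) => match T with 0 => None | T'.+1 => exec P inp T' s' end
  end.

Definition encode (h n c : nat) (deck : seq hcard) : seq nat :=
  [:: h; n; c; size deck] ++ flatten [seq [:: x.1; x.2] | x <- deck].

Definition time_bound (N n c h : nat) : nat :=
  N * (h ^ 2 + h * c) * c ^ h * n ^ (h + c - 1).
Definition space_bound (n c h : nat) : nat :=
  c ^ h * n ^ (h + c - 1).

(* Main.v *)
Require Import Defs.
From mathcomp Require Import all_boot zify.
Set Implicit Arguments. Unset Strict Implicit. Unset Printing Implicit Defensive.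

(* Greedy play is optimal, because a position only improves when the played values
   increase while the hand keeps the cards that are still of use. So at any time the
   only choice is whether to store the card drawn, and a color has value 0 exactly when
   its 1 was not drawn yet; the values of the other colors range over n possibilities.
   The dynamic program keeps a table indexed by the hand (c n possible contents for each
   of the h slots) and the values of the first c - 1 colors, which contains the best value
   of the last color: n^(c-1) (c n)^h cells. A cell is updated in time O(h^2), the cost of
   playing the stored cards that become playable one after the other. Positions are
   packed into single words, as the base n digits of P (values) and the base n c digits
   of H (hand), so that the program never unpacks them into memory. *)

(** * Digits *)

(** Which colors have started depends only on the cards drawn, so it is recorded once per layer; a
    digit of [P] is then the value of its color minus one, which fits in base n. No code is spent on
    empty slots either: a slot is free as soon as its card is no longer useful. The price of both
    savings is that packed positions are not positions of the game: they may contain duplicates and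
    dead cards. Correctness therefore rests on two one-sided simulations. [sound] turns a packed
    position into genuine plays, deciding in hindsight which useful cards were really stored; [dom]
    gives to every genuine play a packed position at least as good. Neither is exact, but the first,
    applied to the empty set of cards, and the second, applied to a winning play, give the two
    directions of the equivalence. *)

Definition dig (b k m : nat) : nat := (m %/ b ^ k) %% b.

Lemma dig_lt b k m : 0 < b -> dig b k m < b.
Proof. by move=> b0; rewrite /dig ltn_mod. Qed.

Lemma divn_add_dig b k m a : 0 < b -> dig b k m + a < b ->
  (m + a * b ^ k) %/ b ^ k.+1 = m %/ b ^ k.+1.
Proof.
move=> b0 lt_b; rewrite expnSr !divnMA [m + _]addnC divnMDl ?expn_gt0 ?b0 // addnC.
rewrite [in LHS](divn_eq (m %/ b ^ k) b) -addnA divnMDl //.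
by rewrite (@divn_small (_ + _)) ?addn0.
Qed.

Lemma dig_add b k m a j : 0 < b -> dig b k m + a < b ->
  dig b j (m + a * b ^ k) = dig b j m + (j == k) * a.
Proof.
move=> b0 lt_b; have bX i : 0 < b ^ i by rewrite expn_gt0 b0.
have [jk|kj|->] := ltngtP j k; rewrite ?mul0n ?mul1n ?addn0 /dig.
- have -> : b ^ k = b ^ (k - j).-1 * b * b ^ j.
    by rewrite -expnSr -expnD; congr (_ ^ _); lia.
  by rewrite mulnA addnC divnMDl // mulnA modnMDl.
- have -> : b ^ j = b ^ k.+1 * b ^ (j - k.+1) by rewrite -expnD; congr (_ ^ _); lia.
  by rewrite divnMA divn_add_dig // -divnMA.
- by rewrite addnC divnMDl // addnC -modnDml modn_small.
Qed.

Lemma ltn_add_dig b k m a e : 0 < b -> k < e -> dig b k m + a < b -> m < b ^ e ->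
  m + a * b ^ k < b ^ e.
Proof.
move=> b0 ke lt_b; have -> : b ^ e = b ^ (e - k.+1) * b ^ k.+1.
  by rewrite -expnD; congr (_ ^ _); lia.
by rewrite -!ltn_divLR ?expn_gt0 ?b0 // divn_add_dig.
Qed.

Lemma dig_mul_le b k m : dig b k m * b ^ k <= m.
Proof.
apply: leq_trans (leq_trunc_div m (b ^ k)).
by rewrite leq_mul2r leq_mod orbT.
Qed.

Lemma dig_clear b k m j : 0 < b ->
  dig b j (m - dig b k m * b ^ k) = if j == k then 0 else dig b j m.
Proof.
move=> b0; set m' := m - _.
have bX i : 0 < b ^ i by rewrite expn_gt0 b0.
have m'k : dig b k m' = 0.
  have mE : m = m %/ b ^ k.+1 * b * b ^ k + dig b k m * b ^ k + m %% b ^ k.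
    by rewrite -mulnDl expnSr divnMA /dig -!divn_eq.
  have -> : m' = m %/ b ^ k.+1 * b * b ^ k + m %% b ^ k.
    by rewrite /m' [X in X - _]mE addnAC addnK.
  by rewrite /dig divnMDl // [_ %% _ %/ _]divn_small ?ltn_pmod // addn0 modnMl.
case: eqP => [->//|/eqP jk].
have mE : m = m' + dig b k m * b ^ k by rewrite subnK ?dig_mul_le.
by rewrite [in RHS]mE dig_add ?m'k ?add0n ?dig_lt // (negbTE jk) addn0.
Qed.

(** The order of the operations is that of [replace_code]; the truncated subtraction is exact by
    [dig_mul_le]. *)
Definition setd b k m a := m + a * b ^ k - dig b k m * b ^ k.

Lemma dig_setd b k m a j : a < b -> dig b j (setd b k m a) = if j == k then a else dig b j m.
Proof.
move=> ab; have b0 : 0 < b by apply: leq_ltn_trans ab.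
rewrite /setd addnC -addnBA ?dig_mul_le // addnC dig_add ?dig_clear ?eqxx //.
by case: eqP => //=; rewrite ?mul1n ?mul0n ?addn0.
Qed.

Lemma setd_lt b k m a e : a < b -> k < e -> m < b ^ e -> setd b k m a < b ^ e.
Proof.
move=> ab ke me; have b0 : 0 < b by apply: leq_ltn_trans ab.
rewrite /setd addnC -addnBA ?dig_mul_le // addnC ltn_add_dig //.
  by rewrite dig_clear // eqxx.
exact: leq_ltn_trans (leq_subr _ _) me.
Qed.

Lemma modn_expS b k m : m %% b ^ k.+1 = m %% b ^ k + dig b k m * b ^ k.
Proof.
case: b => [|b]; first by rewrite /dig exp0n // !modn0; case: k => [|k];
  rewrite ?expn0 ?modn1 ?divn1 ?exp0n // ?modn0 ?muln0 ?muln1 ?addn0.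
have bX i : 0 < b.+1 ^ i by rewrite expn_gt0.
rewrite [in LHS](divn_eq m (b.+1 ^ k)) [X in X * _ + _](divn_eq (m %/ b.+1 ^ k) b.+1).
rewrite -/(dig b.+1 k m) mulnDl -mulnA -expnS -addnA modnMDl addnC modn_small //.
have := ltn_pmod m (bX k); have := @dig_lt b.+1 k m isT; rewrite expnS; nia.
Qed.

(** A position in which every started color has reached n is thus a single number, so the final test
    inspects one cell per hand. *)
Lemma max_digits b e m : 0 < b -> m < b ^ e ->
  (forall k, k < e -> dig b k m = b.-1) <-> m = (b ^ e).-1.
Proof.
move=> b0 me; have bX i : 0 < b ^ i by rewrite expn_gt0 b0.
suff H : (forall k, k < e -> dig b k m = b.-1) <-> m %% b ^ e = (b ^ e).-1.
  by rewrite (modn_small me) in H.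
elim: e {me} => [|e IH]; first by rewrite expn0 modn1; split.
rewrite modn_expS; have d_lt := @dig_lt b e m b0; have m_lt := ltn_pmod m (bX e).
split=> [D|E].
  by have [-> //] := IH.1 (fun k ke => D k (ltnW ke)); rewrite D // expnS; move: (bX e); nia.
have DE : dig b e m = b.-1.
  move: E; rewrite expnS; move: (bX e) => X0 E.
  apply/eqP; rewrite eqn_leq; apply/andP; split; first lia.
  by rewrite leqNgt; apply/negP => lt; nia.
move=> k; rewrite ltnS leq_eqVlt => /orP [/eqP-> //|]; apply: IH.2.
by move: E; rewrite DE expnS; move: (bX e); nia.
Qed.

Lemma count_lt (T : eqType) (a1 a2 : pred T) s y :
  (forall z, a1 z -> a2 z) -> y \in s -> a2 y -> ~~ a1 y -> count a1 s < count a2 s.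
Proof.
move=> sub ys a2y /negbTE a1y; have le s' := @sub_count _ a1 a2 sub s'.
have [s1 [s2 ->]] : exists s1 s2, s = s1 ++ y :: s2 by case/splitPr: ys => s1 s2; exists s1, s2.
rewrite !count_cat /= a1y a2y; have := le s1; have := le s2; lia.
Qed.

(** * The packed dynamic program *)

(* The cards drawn so far are listed most recent first. *)
Fixpoint drawn (h : nat) (d : seq hcard) (p : nat -> nat) (H : seq hcard) : Prop :=
  if d is x :: d' then exists p0 H0, drawn h d' p0 H0 /\ draw_step h x p0 H0 p H
  else p = (fun=> 0) /\ H = [::].

Lemma drawn_reachable h d p H d2 p' H' :
  drawn h d p H -> reachable h d2 p H p' H' ->
  reachable h (catrev d d2) (fun=> 0) [::] p' H'.
Proof.
elim: d p H d2 => [|x d IH] p H d2 /=; first by case=> -> ->.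
by case=> p0 [H0 [D S]] R; apply: (IH _ _ _ D); exists p, H.
Qed.

(** [reachable] fixes the final values only pointwise, whereas [drawn] is exact on functions; hence
    the auxiliary [p'']. *)
Lemma reachable_drawn h d p H d2 p' H' :
  drawn h d p H -> reachable h d2 p H p' H' ->
  exists p'', p'' =1 p' /\ drawn h (catrev d2 d) p'' H'.
Proof.
elim: d2 d p H => [|x d2 IH] d p H /= D.
  by case=> E ->; exists p; split=> // k; rewrite E.
by case=> p1 [H1 [S R]]; apply: (IH (x :: d) _ _ _ R); exists p, H.
Qed.

Lemma winnable_drawn h n c deck : winnable h n c deck <->
  exists p H, drawn h (rev deck) p H /\ forall k, 1 <= k <= c -> p k = n.
Proof.
split=> [[p [H [R W]]]|[p [H [D W]]]].
  have [//|q [E D]] := @reachable_drawn h [::] (fun=> 0) [::] deck p H _ R.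
  by exists q, H; split=> // k /W <-; rewrite E.
exists p, H; split=> //.
have := @drawn_reachable h (rev deck) p H [::] p H D.
by rewrite catrevE revK cats0; apply.
Qed.

(** [play_stored] unfolds from its first play, while the scan of the slots adds one play at the end
    of a finished sequence. *)
Lemma play_stored_rcons p H p' H1 x H2 :
  play_stored p H p' (H1 ++ x :: H2) -> playable p' x ->
  play_stored p H (upd p' x) (H1 ++ H2).
Proof.
move E: (H1 ++ x :: H2) => H' S; elim: S E => [q G <- px|q G1 y G2 q' G' py _ IH E px].
  exact: (ps_step px (ps_refl _ _)).
exact: (ps_step py (IH E px)).
Qed.

(** * Coding of cards and packed positions *)

Section Packed.

Variables h n c : nat.
Hypotheses (n_gt0 : 0 < n) (c_gt0 : 0 < c).

Let B := n * c.
Let B_gt0 : 0 < B. Proof. by rewrite muln_gt0 n_gt0. Qed.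

Definition valid (x : hcard) := (1 <= x.1 <= n) && (1 <= x.2 <= c).
Definition code (x : hcard) : nat := x.1.-1 + n * x.2.-1.
Definition card (g : nat) : hcard := ((g %% n).+1, (g %/ n).+1).

Lemma codeK x : valid x -> card (code x) = x.
Proof.
case: x => a k; rewrite /valid /card /code /= => /andP[/andP[a1 an] /andP[k1 kc]].
rewrite addnC mulnC modnMDl divnMDl // modn_small ?divn_small ?addn0; first by congr (_, _); lia.
all: by lia.
Qed.

Lemma cardK : cancel card code.
Proof. by move=> g; rewrite /card /code /= addnC mulnC -divn_eq. Qed.

Lemma code_lt x : valid x -> code x < B.
Proof. by case: x => a k; rewrite /valid /code /B /=; nia. Qed.

Lemma code_mod x : valid x -> code x %% n = x.1.-1.
Proof. by move/codeK=> {2}<-. Qed.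

Lemma code_div x : valid x -> code x %/ n = x.2.-1.
Proof. by move/codeK=> {2}<-. Qed.

(** A card of value 1 never changes [P], since its remainder modulo n is 0: its play is recorded by
    [sn] alone, which turns the value of the color from 0 to 1 while the digit stays 0. *)
Definition play (sn : nat -> bool) (P g : nat) : nat :=
  P + (sn (g %/ n) && (g %% n == (dig n (g %/ n) P).+1)) * n ^ (g %/ n).

Definition slot (H j : nat) := dig B j H.

Definition scan sn H P := foldl (fun P j => play sn P (slot H j)) P (iota 0 h).

Definition close sn H P := iter h (scan sn H) P.

(* A slot whose card is not [use]ful counts as free; the code 0 of (1,1) is the
   initial content of the slots. *)
Definition use (P g : nat) : bool := dig n (g %/ n) P < g %% n.

Definition closed sn H P := forall j, j < h -> play sn P (slot H j) = P.

Definition wf (sn : nat -> bool) P :=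
  P < n ^ c /\ forall k, k < c -> ~~ sn k -> dig n k P = 0.

Definition val (sn : nat -> bool) (P k : nat) := if sn k then (dig n k P).+1 else 0.

Definition seen (d : seq hcard) (k : nat) := (1, k.+1) \in d.

(** * Playing and closing packed positions *)

Lemma slot_div H j : slot H j %/ n < c.
Proof. by rewrite ltn_divLR // mulnC -/B dig_lt. Qed.

(** No carry can occur: a digit that increases becomes [g %% n], which is below n. *)
Lemma dig_play sn P g k : dig n k (play sn P g) =
  dig n k P + [&& k == g %/ n, sn k & g %% n == (dig n k P).+1].
Proof.
rewrite /play; case: (boolP (sn _ && _)) => [/andP[s /eqP e]|ns]; last first.
  rewrite mul0n addn0; case: eqP => [->|]; last by rewrite addn0.
  by rewrite (negbTE ns) addn0.
rewrite dig_add // ?muln1; last by rewrite addn1 -e ltn_mod.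
by case: eqP => //= ->; rewrite s e eqxx.
Qed.

Lemma leq_dig_play sn P g k : dig n k P <= dig n k (play sn P g).
Proof. by rewrite dig_play leq_addr. Qed.

Lemma wf_play sn P g : g %/ n < c -> wf sn P -> wf sn (play sn P g).
Proof.
move=> gc [Pc P0]; split.
  rewrite /play; case: (boolP (sn _ && _)) => [/andP[s /eqP e]|ns]; last by rewrite addn0.
  by rewrite ltn_add_dig // addn1 -e ltn_mod.
by move=> k kc nk; rewrite dig_play (negbTE nk) /= andbF addn0 P0.
Qed.

Lemma use_play sn P g y : use (play sn P g) y -> use P y.
Proof. exact: leq_ltn_trans (leq_dig_play _ _ _ _). Qed.

Lemma play_neq sn P g : play sn P g != P ->
  [/\ sn (g %/ n), g %% n = (dig n (g %/ n) P).+1, use P g & ~~ use (play sn P g) g].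
Proof.
rewrite /use dig_play eqxx /= /play; case: (sn _) => /=; last by rewrite mul0n addn0 eqxx.
have [->|_] := eqVneq (g %% n); last by rewrite mul0n addn0 eqxx.
by rewrite addn1 ltnn ltnSn.
Qed.

Lemma foldl_play_ind sn H (I : nat -> Prop) s P :
  (forall j, j \in s -> j < h) ->
  (forall Q j, j < h -> I Q -> I (play sn Q (slot H j))) -> I P ->
  I (foldl (fun P j => play sn P (slot H j)) P s).
Proof.
move=> sh step; elim: s P sh => //= j s IH P sh IP; apply: IH => [i si|].
  by apply: sh; rewrite inE si orbT.
by apply: step IP; apply: sh; rewrite inE eqxx.
Qed.

Lemma scan_ind sn H (I : nat -> Prop) P :
  (forall Q j, j < h -> I Q -> I (play sn Q (slot H j))) -> I P -> I (scan sn H P).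
Proof. by move=> step; apply: foldl_play_ind step => j; rewrite mem_iota. Qed.

Lemma iter_scan_ind sn H (I : nat -> Prop) t P :
  (forall Q j, j < h -> I Q -> I (play sn Q (slot H j))) -> I P ->
  I (iter t (scan sn H) P).
Proof. by move=> step IP; elim: t => //= t; apply: scan_ind. Qed.

Lemma wf_iter_scan sn H t P : wf sn P -> wf sn (iter t (scan sn H) P).
Proof. by apply: iter_scan_ind => Q j _; apply: wf_play; apply: slot_div. Qed.

Lemma wf_close sn H P : wf sn P -> wf sn (close sn H P).
Proof. exact: wf_iter_scan. Qed.

Lemma leq_dig_close sn H P k : dig n k P <= dig n k (close sn H P).
Proof.
apply: (@iter_scan_ind sn H (fun Q => dig n k P <= dig n k Q)) => // Q j _ le.
exact: leq_trans le (leq_dig_play _ _ _ _).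
Qed.

Lemma close_id sn H P : closed sn H P -> close sn H P = P.
Proof. by move=> cl; apply: (@iter_scan_ind sn H (fun Q => Q = P)) => // Q j jh ->; apply: cl. Qed.

(* Each effective scan kills at least one of the [h] useful slots. *)
Lemma close_closed sn H P : closed sn H (close sn H P).
Proof.
pose nuse Q := count (fun j => use Q (slot H j)) (iota 0 h).
have scanP Q : closed sn H Q \/ nuse (scan sn H Q) < nuse Q.
  have [|[j jh [uj nuj]]] : closed sn H Q \/
      exists2 j, j \in iota 0 h & use Q (slot H j) /\ ~~ use (scan sn H Q) (slot H j).
    have -> : closed sn H Q <-> forall j, j \in iota 0 h -> play sn Q (slot H j) = Q.
      by split=> cl j; have := cl j; rewrite mem_iota.
    rewrite /scan; have : forall j, j \in iota 0 h -> j < h by move=> j; rewrite mem_iota.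
    elim: (iota 0 h) Q => [|j s IH] Q sh /=; first by left.
    have sh' : forall i, i \in s -> i < h by move=> i si; apply: sh; rewrite inE si orbT.
    have [E|/play_neq [_ _ u nu]] := eqVneq (play sn Q (slot H j)) Q.
      rewrite E; case: (IH Q sh') => [cl|[i si ui]]; [left|right].
        by move=> i; rewrite inE => /orP[/eqP->//|]; apply: cl.
      by exists i; rewrite // inE si orbT.
    right; exists j; rewrite ?inE ?eqxx //; split=> //; apply: contra nu.
    apply: (@foldl_play_ind sn H
      (fun Q' => use Q' (slot H j) -> use (play sn Q (slot H j)) (slot H j))) => // Q' i _ IQ.
    by move/use_play.
  - by left.
  - right; apply: (count_lt _ jh uj nuj) => i.
    apply: (@scan_ind sn H (fun Q' => use Q' (slot H i) -> use Q (slot H i))) => //.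
    by move=> Q' k _ IQ /use_play.
(* After t scans either the position is closed or at least t of the h slots have become useless.
   Only the number of scans is generalized, not the number of slots. *)
have : closed sn H (close sn H P) \/ nuse (close sn H P) + h <= h.
  rewrite /close; move: {1 2 3}h => t.
  elim: t => [|t [cl|IH]] /=; first by right; rewrite addn0 -[X in _ <= X](size_iota 0) count_size.
    by left; rewrite (@scan_ind sn H (fun Q => Q = iter t (scan sn H) P)) // => Q j jh ->; apply: cl.
  case: (scanP (iter t (scan sn H) P)) => [cl|lt]; last by right; lia.
  by left; rewrite (@scan_ind sn H (fun Q => Q = iter t (scan sn H) P)) // => Q j jh ->; apply: cl.
rewrite -{2}[h]add0n leq_add2r leqn0 => -[//|/eqP u0] j jh; apply/eqP/negPn/negP => /play_neq [_ _ u _].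
have : has (fun j => use (close sn H P) (slot H j)) (iota 0 h).
  by apply/hasP; exists j; rewrite ?mem_iota.
by rewrite has_count -/(nuse (close sn H P)) u0.
Qed.

(** * Soundness and domination of packed positions *)

Definition held P H y := exists2 j, j < h & y = card (slot H j) /\ use P (slot H j).

Definition agree (sn : nat -> bool) P (p : nat -> nat) := forall k, k < c -> p k.+1 = val sn P k.

(* The model cannot get rid of a stored card other than by playing it, whereas a
   packed state forgets duplicates and dead cards; hence the quantification over
   the sets of useful cards. *)
Definition sound d P H := forall U, uniq U -> (forall y, y \in U -> held P H y) ->
  exists p H', drawn h d p H' /\ agree (seen d) P p /\ perm_eq H' U.

Definition entry_ok d P H :=
  [/\ wf (seen d) P, H < B ^ h, closed (seen d) H P & sound d P H].

(** The packed position is at least as good as the genuine [p], [Hm]. The last two clauses inject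
    the useful slots into [Hm], so that a slot is free whenever the game has room for a card. The
    condition on stored cards of value 1 excludes such a card when its color counts as not
    started. *)
Definition dom (sn : nat -> bool) (p : nat -> nat) (Hm : seq hcard) P H :=
  [/\ forall k, k < c -> p k.+1 <= val sn P k,
      forall y, y \in Hm -> [/\ valid y, y.1 = 1 -> sn y.2.-1 &
        use P (code y) -> exists2 j, j < h & slot H j = code y],
      forall j, j < h -> use P (slot H j) -> card (slot H j) \in Hm &
      forall i j, i < h -> j < h -> use P (slot H i) -> slot H i = slot H j -> i = j].

(** Distinct held cards occupy distinct slots; this provides the room required by [ds_store] when a
    packed store is realized in the game. *)
Lemma held_size P H U : uniq U -> (forall y, y \in U -> held P H y) -> size U <= h.
Proof.
move=> uU hU; rewrite -[h](size_iota 0) -(size_map (fun j => card (slot H j))).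
apply: uniq_leq_size => // y /hU [j jh [-> _]]; apply/mapP; exists j => //.
by rewrite mem_iota.
Qed.

Lemma playE (sn : nat -> bool) P g :
  play sn P g = P <-> ~~ (sn (g %/ n) && (g %% n == (dig n (g %/ n) P).+1)).
Proof.
rewrite /play; case: (_ && _); split=> //; last by rewrite mul0n addn0.
by have : 0 < n ^ (g %/ n) by [rewrite expn_gt0 n_gt0]; lia.
Qed.

Lemma seen_cons d x k : 0 < x.2 ->
  seen (x :: d) k = (x.1 == 1) && (k == x.2.-1) || seen d k.
Proof.
case: x => a [|k'] //= _; rewrite /seen in_cons; congr (_ || _).
by rewrite xpair_eqE eqSS [1 == a]eq_sym.
Qed.

(** * The effect of one draw *)

Section Step.

Variables (d : seq hcard) (x : hcard) (P H : nat).
Hypotheses (vx : valid x) (Pok : entry_ok d P H).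

Let sn := seen d.
Let sn' := seen (x :: d).
Let k0 := x.2.-1.
Let P1 := play sn' P (code x).
Let P2 := close sn' H P1.
(** Playability is tested against the values before the draw, because drawing a 1 may change [seen]
    but not [P]. *)
Let can := x.1 == (val sn P k0).+1.

Let k0_lt : k0 < c. Proof. by move: vx; rewrite /valid /k0; lia. Qed.
Let xE : x = (x.1, k0.+1).
Proof. by rewrite /k0; move: vx; rewrite /valid; case: (x) => a [|k] //=; rewrite andbF. Qed.

Let x2E : x.2 = k0.+1. Proof. by rewrite [in LHS]xE. Qed.

Let sn'E k : sn' k = (x.1 == 1) && (k == k0) || sn k.
Proof. by apply: seen_cons; rewrite x2E. Qed.

Let wf' : wf sn' P.
Proof.
have [[Pc P0] _ _ _] := Pok; split=> // k kc.
by rewrite sn'E negb_or => /andP[_]; apply: P0.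
Qed.

Let wf2 : wf sn' P2.
Proof. by apply: wf_close; apply: wf_play => //; rewrite code_div. Qed.

Let closed2 : closed sn' H P2. Proof. exact: close_closed. Qed.

Let dig2 k : dig n k P <= dig n k P2.
Proof. by apply: leq_trans (leq_dig_close _ _ _ _); apply: leq_dig_play. Qed.

Let val2 k : val sn P k <= val sn' P2 k.
Proof. by rewrite /val sn'E; case: (sn k) => //; rewrite orbT ltnS. Qed.

Let use2 y : use P2 y -> use P y. Proof. exact: leq_ltn_trans (dig2 _). Qed.

Let val1 : can -> forall k, k < c -> val sn' P1 k = if k == k0 then x.1 else val sn P k.
Proof.
have [[_ P0] _ _ _] := Pok; move=> cn k kc.
rewrite /val dig_play // code_div // code_mod // -/k0 sn'E; move: cn; rewrite /can /val.
have [->|_] := eqVneq k k0; last by rewrite andbF addn0.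
have := P0 k0 k0_lt; rewrite -/sn andbT /=; case: (sn k0) => [_|->//] /eqP ->.
  by rewrite !orbT /= eqxx addn1.
by [].
Qed.

(** An unplayable card of value 1 belongs to a color that has already started, so the set of seen
    colors does not change either. *)
Let no_can : ~~ can -> sn' =1 sn /\ P1 = P.
Proof.
move=> nc; have E : sn' =1 sn.
  move=> k; rewrite sn'E; case: eqP => //= x1; case: eqP => //= ->.
  by move: nc; rewrite /can /val x1; case: (sn k0).
split=> //; apply/playE; rewrite code_div // code_mod // -/k0 E.
apply: contra nc => /andP[s /eqP e]; rewrite /can /val s.
by move: vx e; rewrite /valid; case: (x.1) => //= a _ ->.
Qed.

Let no_can2 : ~~ can -> P2 = P.
Proof.
move=> /no_can [E E1]; rewrite /P2 E1; apply: close_id => j jh.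
by have [_ _ cl _] := Pok; rewrite -[RHS](cl j jh) /play E.
Qed.

Let can_use : can -> ~~ use P2 (code x).
Proof.
move=> cn; rewrite /use code_div // code_mod // -/k0 -leqNgt.
have := val1 cn k0_lt; rewrite eqxx /val.
have := leq_dig_close sn' H P1 k0; rewrite -/P2.
by case: (sn' k0) => // + <-.
Qed.

Let sound_play : can -> sound (x :: d) P2 H.
Proof.
move=> cn; have [_ _ _ snd] := Pok.
(* [mid Q] says that the values [Q] are reached by playing [x] and then stored cards, with any
   prescribed set of useful cards left over. It is invariant under the play of one slot. *)
pose mid Q := forall U, uniq U -> (forall y, y \in U -> held Q H y) ->
  exists p0 H0 p' H', [/\ drawn h d p0 H0, playable p0 x, play_stored (upd p0 x) H0 p' H',
    agree sn' Q p' & perm_eq H' U].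
suff: mid P2.
  move=> m2 U uU hU; have [p0 [H0 [p' [H' [D px S A E]]]]] := m2 U uU hU.
  exists p', H'; split; last by split.
  by exists p0, H0; split=> //; apply: ds_play.
apply: (@iter_scan_ind sn' H mid) => [Q j jh mQ|].
  have [->//|nQ] := eqVneq (play sn' Q (slot H j)) Q.
  have [s e u nu] := play_neq nQ; set g := slot H j in s e u nu *.
  move=> U uU hU; have yU : card g \notin U.
    by apply: contraNN nu => /hU [i _ [/(can_inj (@cardK)) <-]].
  (* To be played now, [card g] must have been kept until now, so the hypothesis is used for [U]
     with [card g] added; it is not in [U], because after its play it is no longer useful. *)
  have [||p0 [H0 [p' [H' [D px S A E]]]]] := mQ (card g :: U).
  - by rewrite /= yU.
  - move=> y; rewrite inE => /orP[/eqP ->|/hU [i ih [-> ui]]]; first by exists j.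
    by exists i => //; split=> //; apply: use_play ui.
  have yH' : card g \in H' by rewrite (perm_mem E) inE eqxx.
  case/splitPr: yH' S E => H1 H2 S E.
  have gc : g %/ n < c by apply: slot_div.
  have py : playable p' (card g) by rewrite /playable /= A // /val s e.
  exists p0, H0, (upd p' (card g)), (H1 ++ H2); split=> //.
  + exact: play_stored_rcons.
  + move=> k kc; rewrite /upd /= eqSS /val dig_play //.
    by case: eqP => [->|_]; rewrite ?s /= ?e ?eqxx ?addn1 ?addn0 // A.
  + by rewrite -(perm_cons (card g)); move: E; rewrite (perm_catCA H1 [:: card g] H2).
move=> U uU hU; have [|p [H' [D [A E]]]] := snd U uU.
  by move=> y /hU [i ih [-> ui]]; exists i => //; split=> //; apply: use_play ui.
exists p, H', (upd p x), H'; split=> //.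
- by move: cn; rewrite /can /playable x2E A // => /eqP ->; rewrite eqxx.
- exact: ps_refl.
- move=> k kc; rewrite val1 // /upd x2E eqSS.
  by case: eqP => // _; apply: A.
Qed.

Let sound2 : sound (x :: d) P2 H.
Proof.
have [/sound_play//|nc] := boolP can.
rewrite (no_can2 nc) => U uU hU; have [_ _ _ snd] := Pok.
have [p [H' [D [A E]]]] := snd U uU hU.
exists p, H'; split; first by exists p, H'; split=> //; apply: ds_discard.
by split=> // k kc; rewrite /val -/sn' (no_can nc).1 A.
Qed.

Lemma entry_ok_keep : entry_ok (x :: d) P2 H.
Proof. by have [_ HB _ _] := Pok; split. Qed.

(** If [U] contains [x], then [x] is still useful, hence was not playable and the values did not
    move: the game realizes [U] without [x] before the draw and then stores [x]. If [U] does not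
    contain [x], its cards lie in the unchanged slots and [sound2] applies. *)
Lemma entry_ok_store j : j < h -> ~~ use P2 (slot H j) ->
  entry_ok (x :: d) P2 (setd B j H (code x)).
Proof.
move=> jh nuj; have [_ HB cl snd] := Pok; have xB := code_lt vx.
have slotE i : slot (setd B j H (code x)) i = if i == j then code x else slot H i.
  by rewrite /slot dig_setd.
split=> //; first exact: setd_lt.
  move=> i ih; rewrite slotE; case: eqP => [_|_]; last exact: closed2.
  have [cn|nc] := boolP can; last by rewrite no_can2 //; exact: (no_can nc).2.
  apply/playE; rewrite negb_and; apply/orP; right.
  have := can_use cn; rewrite /use -leqNgt; lia.
move=> U uU hU; have [xU|xU] := boolP (x \in U); last first.
  apply: sound2 => // y yU; have [i ih []] := hU y yU; rewrite slotE.
  case: eqP => [_|_ -> u]; last by exists i.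
  by rewrite codeK // => Ey; rewrite -Ey yU in xU.
have ux : use P2 (code x).
  have [i ih []] := hU x xU; rewrite slotE; case: eqP => // _ Ex.
  by rewrite [in code x]Ex cardK.
have nc : ~~ can by apply: contraL ux => /can_use.
have [||p [H' [D [A E]]]] := snd (rem x U); first exact: rem_uniq.
  move=> y; rewrite mem_rem_uniq // inE => /andP[yx yU]; have [i ih []] := hU y yU.
  rewrite slotE; case: eqP => [_|_ -> u]; first by rewrite codeK // => Ey; rewrite Ey eqxx in yx.
  by exists i => //; split=> //; apply: use2.
exists p, (x :: H'); split; last split.
- exists p, H'; split=> //; apply: ds_store.
  rewrite (perm_size E) size_rem //; have := held_size uU hU.
  by case: (U) xU.
- by move=> k kc; rewrite no_can2 // /val -/sn' (no_can nc).1 A.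
- by rewrite perm_sym (permPl (perm_to_rem xU)) perm_cons perm_sym.
Qed.

(** Closedness of [P2] is the point: a stored card that would take the game beyond the packed value
    of its color would be useful, hence lie in a slot, and that slot would still be playable. *)
Let dom_play_stored p Hm p' Hm' :
  dom sn' p Hm P2 H -> play_stored p Hm p' Hm' -> dom sn' p' Hm' P2 H.
Proof.
move=> D S; elim: S D => // {p Hm p' Hm'} p H1 y H2 p' Hm' py _ IH [Dp Din Dmem Du].
apply: IH; have [vy y1s uy] : [/\ valid y, y.1 = 1 -> sn' y.2.-1 &
    use P2 (code y) -> exists2 j, j < h & slot H j = code y].
  by apply: Din; rewrite mem_cat inE eqxx orbT.
have yk : y.2.-1 < c by move: vy; rewrite /valid; lia.
have yE : y.2.-1.+1 = y.2 by move: vy; rewrite /valid; lia.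
have y_le : y.1 <= val sn' P2 y.2.-1.
  rewrite leqNgt; apply/negP => lt; have := Dp _ yk; rewrite yE.
  move: py lt; rewrite /playable => /andP[y0 /eqP->].
  rewrite /val; case s: (sn' _) => // lt le.
    have e : y.1.-1 = (dig n y.2.-1 P2).+1 by lia.
    have u : use P2 (code y) by rewrite /use code_mod // code_div // e.
    have [j jh Ej] := uy u; have := closed2 jh; rewrite Ej => /playE.
    by rewrite code_mod // code_div // s e eqxx.
  have y1 : y.1 = 1 by lia.
  by have := y1s y1; rewrite s.
split=> //.
- move=> k kc; rewrite /upd; case: eqP => [E|_]; last exact: Dp.
  by move: y_le; rewrite -E.
- by move=> z zH; apply: Din; move: zH; rewrite !mem_cat inE => /orP[->|->]; rewrite ?orbT.
- move=> j jh uj; have := Dmem j jh uj; rewrite !mem_cat inE.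
  move=> /or3P[->//|/eqP Ej|->]; last by rewrite orbT.
  exfalso; have yc : slot H j = code y by rewrite -Ej cardK.
  move: uj y_le; rewrite yc /use code_mod // code_div // /val.
  by case: (sn' _); lia.
Qed.

Let dom_keep p Hm : dom sn p Hm P H -> dom sn' p Hm P2 H.
Proof.
case=> [Dp Din Dmem Du]; split.
- by move=> k kc; apply: leq_trans (Dp k kc) (val2 k).
- move=> y /Din [vy y1 uy]; split=> // [/y1|/use2 //]; rewrite sn'E => ->.
  by rewrite orbT.
- by move=> j jh /use2; apply: Dmem.
- by move=> i j ih jh /use2; apply: Du.
Qed.

Lemma dom_step p Hm p' Hm' : dom sn p Hm P H -> draw_step h x p Hm p' Hm' ->
  dom sn' p' Hm' P2 H \/
  exists2 j, j < h & ~~ use P2 (slot H j) /\ dom sn' p' Hm' P2 (setd B j H (code x)).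
Proof.
move=> D S; have D' := dom_keep D; case: S D D' => {p Hm p' Hm'}.
- by left.
- move=> p Hm Hm_lt _ [Dp Din Dmem Du].
  have x1 : x.1 = 1 -> sn' x.2.-1 by move=> x1; rewrite sn'E x1 /= eqxx.
  have in_step H' : (forall y, y \in Hm -> use P2 (code y) -> exists2 j, j < h & slot H' j = code y) ->
      (use P2 (code x) -> exists2 j, j < h & slot H' j = code x) ->
      forall y, y \in x :: Hm -> [/\ valid y, y.1 = 1 -> sn' y.2.-1 &
        use P2 (code y) -> exists2 j, j < h & slot H' j = code y].
    move=> IHm Ix y; rewrite inE => /orP[/eqP->//|yHm].
    by have [vy y1 _] := Din y yHm; split=> //; apply: IHm.
  have [/andP[ux nx]|nux] := boolP (use P2 (code x) && ~~ has (fun j => slot H j == code x) (iota 0 h)).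
    have [j jh nuj] : exists2 j, j < h & ~~ use P2 (slot H j).
      have [/allP au|/allPn [j]] := boolP (all (fun j => use P2 (slot H j)) (iota 0 h)); last first.
        by rewrite mem_iota => jh nu; exists j.
      suff : h <= size Hm by lia.
      rewrite -[h](size_iota 0) -(size_map (fun j => card (slot H j))).
      apply: uniq_leq_size => [|y /mapP [j jh ->]].
        rewrite map_inj_in_uniq ?iota_uniq // => i j ih jh /(can_inj (@cardK)) E.
        have ui := au _ ih; rewrite !mem_iota in ih jh; exact: (Du i j ih jh ui E).
      have uj := au _ jh; rewrite mem_iota in jh; exact: Dmem jh uj.
    right; exists j => //; split=> //.
    have slotE i : slot (setd B j H (code x)) i = if i == j then code x else slot H i.
      by rewrite /slot dig_setd // code_lt.
    have slot_nx i : i < h -> slot H i != code x.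
      by move=> ih; move/hasPn: nx => /(_ i); rewrite mem_iota; apply.
    split=> //.
    + apply: in_step => [y /Din [_ _ uy] /[dup] u /uy [i ih Ei]|_]; last first.
        by exists j; rewrite // slotE eqxx.
      exists i => //; rewrite slotE; case: eqP => // Eij.
      by move: nuj; rewrite -Eij Ei u.
    + move=> i ih; rewrite slotE; case: eqP => [_ _|_ ui]; first by rewrite codeK // inE eqxx.
      by rewrite inE Dmem ?orbT.
    + move=> i i' ih i'h; rewrite !slotE; case: eqP => [->|_]; case: eqP => [->|_] //.
      * by move=> _ E; have := slot_nx i' i'h; rewrite -E eqxx.
      * by move=> _ E; have := slot_nx i ih; rewrite E eqxx.
      * by move=> u E; apply: Du.
  left; split=> //; first apply: in_step.
  + by move=> y /Din [].
  + move: nux; rewrite negb_and negbK => /orP[/negbTE->//|/hasP [j]].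
    by rewrite mem_iota => jh /eqP Ej _; exists j.
  + by move=> j jh uj; rewrite inE Dmem ?orbT.
- move=> p Hm p' Hm' px S [Dp _ _ _] [Dp' Din Dmem Du].
  left; apply: (dom_play_stored _ S); split=> // k kc; rewrite /upd.
  case: eqP => [|_]; last exact: Dp'.
  rewrite x2E => -[->]; move: px; rewrite /playable x2E => /andP[x0 /eqP E].
  (* If [x] is playable in the game but not in the packed position, domination forces the packed
     value of its color to be at least [x.1] already. *)
  have [cn|nc] := boolP can.
    have := val1 cn k0_lt; rewrite eqxx => <-.
    rewrite /val; case: (sn' k0) => //; rewrite ltnS; exact: leq_dig_close.
  apply: leq_trans (val2 _); have := Dp k0 k0_lt; rewrite E; move: nc; rewrite /can.
  by lia.
Qed.

End Step.

(** The second option does not ask whether [x] has just been played: a dead card in a free slot is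
    harmless, and the program saves a test. *)
Definition succ d x P H P' H' :=
  P' = close (seen (x :: d)) H (play (seen (x :: d)) P (code x)) /\
  (H' = H \/ exists2 j, j < h & ~~ use P' (slot H j) /\ H' = setd B j H (code x)).

Lemma entry_ok_succ d x P H P' H' : valid x -> entry_ok d P H -> succ d x P H P' H' ->
  entry_ok (x :: d) P' H'.
Proof.
move=> vx ok [-> [->|[j jh [nu ->]]]]; first exact: entry_ok_keep.
exact: entry_ok_store.
Qed.

Lemma dom_succ d x P H p Hm p' Hm' : valid x -> entry_ok d P H -> dom (seen d) p Hm P H ->
  draw_step h x p Hm p' Hm' ->
  exists P' H', succ d x P H P' H' /\ dom (seen (x :: d)) p' Hm' P' H'.
Proof.
move=> vx ok D S; exists (close (seen (x :: d)) H (play (seen (x :: d)) P (code x))).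
have [D'|[j jh [nu D']]] := dom_step vx ok D S; first by exists H; split=> //; split=> //; left.
by exists (setd B j H (code x)); split=> //; split=> //; right; exists j.
Qed.

(* A packed state [(P, H)] is filed under the index [idx P H] with the value
   [P %/ n ^ c.-1 + 1], so that a cell retains the highest value reached in the
   last color; the value 0 marks an empty cell. *)
Definition idx P H := P %% n ^ c.-1 + n ^ c.-1 * H.

Let Z := n ^ c.-1 * B ^ h.

Definition entry (f : nat -> nat) P H :=
  [/\ P < n ^ c, H < B ^ h & f (idx P H) = (P %/ n ^ c.-1).+1].

(** Every nonempty cell comes from [L], and every state of [L] is matched by a cell at least as
    good. Only these bounds are kept, so the order of the writes is irrelevant. *)
Definition files (f : nat -> nat) (L : nat -> nat -> Prop) :=
  (forall j, j < Z -> f j <= n) /\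
  (forall P H, entry f P H -> L P H) /\
  (forall P H, L P H -> [/\ P < n ^ c, H < B ^ h & P %/ n ^ c.-1 < f (idx P H)]).

Let NP_gt0 : 0 < n ^ c.-1. Proof. by rewrite expn_gt0 n_gt0. Qed.
Let ncE : n ^ c = n * n ^ c.-1. Proof. by rewrite -expnS prednK. Qed.

(** * Filing positions in the table *)

Lemma idx_lt P H : H < B ^ h -> idx P H < Z.
Proof. by rewrite /idx /Z => Hh; have := ltn_pmod P NP_gt0; nia. Qed.

Lemma idx_mod P H : idx P H %% n ^ c.-1 = P %% n ^ c.-1.
Proof. by rewrite /idx addnC mulnC modnMDl modn_mod. Qed.

Lemma idx_div P H : idx P H %/ n ^ c.-1 = H.
Proof. by rewrite /idx addnC mulnC divnMDl // divn_small ?addn0 // ltn_pmod. Qed.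

Lemma idx_inj P H P' H' : idx P H = idx P' H' -> P %/ n ^ c.-1 = P' %/ n ^ c.-1 ->
  P = P' /\ H = H'.
Proof.
move=> E E'; have := congr1 (modn^~ (n ^ c.-1)) E; have := congr1 (divn^~ (n ^ c.-1)) E.
rewrite !idx_mod !idx_div => -> Em; split=> //.
by rewrite (divn_eq P (n ^ c.-1)) (divn_eq P' (n ^ c.-1)) Em E'.
Qed.

Definition unfile (f : nat -> nat) j := j %% n ^ c.-1 + (f j).-1 * n ^ c.-1.

Lemma entry_unfile f j : j < Z -> 0 < f j <= n ->
  entry f (unfile f j) (j %/ n ^ c.-1) /\ idx (unfile f j) (j %/ n ^ c.-1) = j.
Proof.
move=> jZ /andP[fj0 fjn]; rewrite /unfile; set P := _ + _.
have jm := ltn_pmod j NP_gt0.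
have Pm : P %% n ^ c.-1 = j %% n ^ c.-1 by rewrite /P addnC modnMDl modn_mod.
have Pd : P %/ n ^ c.-1 = (f j).-1 by rewrite /P addnC divnMDl // divn_small ?addn0.
have E : idx P (j %/ n ^ c.-1) = j by rewrite /idx Pm addnC mulnC -divn_eq.
split=> //; split; last by rewrite E Pd prednK.
  by rewrite ncE -ltn_divLR // Pd prednK.
by rewrite ltn_divLR // mulnC.
Qed.

Lemma unfile_entry f P H : entry f P H -> unfile f (idx P H) = P.
Proof. by case=> _ _ E; rewrite /unfile E /= idx_mod addnC -divn_eq. Qed.

Lemma div_lt P : P < n ^ c -> P %/ n ^ c.-1 < n.
Proof. by rewrite ncE ltn_divLR. Qed.

Lemma files_iff f L L' : (forall P H, L P H <-> L' P H) -> files f L -> files f L'.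
Proof. by move=> E [fn [s b]]; split=> //; split=> [P H /s /E|P H /E /b]. Qed.

Lemma files_eq f f' L : (forall j, j < Z -> f j = f' j) -> files f L -> files f' L.
Proof.
move=> E [fn [s b]]; split; [|split].
- by move=> j jZ; rewrite -E ?fn.
- by move=> P H [Pc Hh e]; apply: s; split; rewrite // E ?idx_lt.
- by move=> P H /b [Pc Hh lt]; split; rewrite // -E ?idx_lt.
Qed.

Lemma files_empty f : (forall j, j < Z -> f j = 0) -> files f (fun _ _ => False).
Proof.
move=> f0; split=> [j /f0-> //|]; split=> // P H [_ Hh].
by rewrite f0 ?idx_lt.
Qed.

Lemma files_write f L P H f' : files f L -> P < n ^ c -> H < B ^ h ->
  (forall j, j < Z -> f' j = if j == idx P H then maxn (f j) (P %/ n ^ c.-1).+1 else f j) ->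
  files f' (fun P' H' => L P' H' \/ P' = P /\ H' = H).
Proof.
move=> [fn [s b]] Pc Hh f'E; split; [|split].
- move=> j jZ; rewrite f'E //; case: eqP => _; last exact: fn.
  by rewrite geq_max fn // div_lt.
- move=> P' H' [P'c H'h]; rewrite f'E ?idx_lt //; case: eqP => [E|_ e]; last by left; apply: s.
  rewrite /maxn; case: ltnP => _ e; last by left; apply: s; split.
  by right; apply: idx_inj => //; case: e.
- move=> P' H' [/b [? ? lt]|[-> ->]]; split=> //; rewrite f'E ?idx_lt //.
    by case: ifP => // _; rewrite leq_max lt.
  by rewrite eqxx leq_max ltnSn orbT.
Qed.

(** * The table after a given list of draws *)

Definition table_ok d f :=
  [/\ forall j, j < Z -> f j <= n, forall P H, entry f P H -> entry_ok d P H &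
    forall p Hm, drawn h d p Hm -> exists P H, entry f P H /\ dom (seen d) p Hm P H].

Lemma table_ok_eq d f f' : (forall j, j < Z -> f j = f' j) -> table_ok d f -> table_ok d f'.
Proof.
move=> E [fn ok cpl].
have ent P H : entry f P H <-> entry f' P H.
  by split=> -[Pc Hh e]; split; rewrite // -?E ?idx_lt // E ?idx_lt.
split=> [j jZ|P H /ent /ok //|p Hm /cpl [P [H [/ent e D]]]]; first by rewrite -E ?fn.
by exists P, H.
Qed.

Lemma dig_low k P : k < c.-1 -> dig n k P = dig n k (P %% n ^ c.-1).
Proof.
move=> kc; rewrite /dig {1}(divn_eq P (n ^ c.-1)).
have -> : n ^ c.-1 = n ^ (c.-1 - k).-1 * n * n ^ k.
  by rewrite -expnSr -expnD; congr (_ ^ _); lia.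
by rewrite [in X in (X + _) %/ _]mulnA divnMDl ?expn_gt0 ?n_gt0 // mulnA modnMDl.
Qed.

Lemma dig_top P : P < n ^ c -> dig n c.-1 P = P %/ n ^ c.-1.
Proof. by move=> Pc; rewrite /dig modn_small // div_lt. Qed.

(** This is why a cell may forget all but the largest last digit: raising that digit only makes
    cards useless. *)
Lemma dom_le sn p Hm P P' H : P < n ^ c -> P' < n ^ c ->
  P %% n ^ c.-1 = P' %% n ^ c.-1 -> P %/ n ^ c.-1 <= P' %/ n ^ c.-1 ->
  dom sn p Hm P H -> dom sn p Hm P' H.
Proof.
move=> Pc P'c E le [Dp Din Dmem Du].
have dle k : k < c -> dig n k P <= dig n k P'.
  move=> kc; have [kl|kl] := ltnP k c.-1; first by rewrite (dig_low P kl) (dig_low P' kl) E.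
  by have -> : k = c.-1; [lia | rewrite !dig_top].
have ule g : g %/ n < c -> use P' g -> use P g.
  by move=> /dle; apply: leq_ltn_trans.
split.
- by move=> k kc; apply: leq_trans (Dp k kc) _; rewrite /val; case: (sn k); rewrite ?ltnS ?dle.
- move=> y /Din [vy y1 uy]; split=> // u; apply: uy; apply: ule u.
  by rewrite code_div //; move: vy; rewrite /valid; lia.
- by move=> j jh u; apply: Dmem => //; apply: ule u; apply: slot_div.
- by move=> i j ih jh u; apply: Du => //; apply: ule u; apply: slot_div.
Qed.

Lemma table_ok_step d x f f' : valid x -> table_ok d f ->
  files f' (fun P' H' => exists P H, entry f P H /\ succ d x P H P' H') ->
  table_ok (x :: d) f'.
Proof.
move=> vx [fn ok cpl] [f'n [s b]]; split=> //.
  by move=> P' H' /s [P [H [/ok e S]]]; apply: entry_ok_succ S.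
move=> p' Hm' /= [p [Hm [/cpl [P [H [e D]]] S]]].
have [P' [H' [SS D']]] := dom_succ vx (ok _ _ e) D S.
have [P'c H'h lt] : [/\ P' < n ^ c, H' < B ^ h & P' %/ n ^ c.-1 < f' (idx P' H')].
  by apply: b; exists P, H.
have f'b : 0 < f' (idx P' H') <= n by rewrite f'n ?idx_lt // andbT; apply: leq_ltn_trans lt.
have [e' E'] := entry_unfile (idx_lt P' H'h) f'b; rewrite idx_div in e' E'.
(* The cell may contain a higher last digit than that of [P']; [dom_le] passes to the position
   actually filed. *)
exists (unfile f' (idx P' H')), H'; split=> //.
apply: dom_le D' => //; first by case: e'.
  by rewrite -(idx_mod (unfile _ _) H') E' idx_mod.
rewrite /unfile idx_mod addnC divnMDl //; apply: leq_trans (leq_addr _ _).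
by case: (f' _) lt.
Qed.

Lemma dig0 k : dig n k 0 = 0. Proof. by rewrite /dig div0n mod0n. Qed.

Lemma table_ok_init (f : nat -> nat) : (forall j, j < Z -> f j = (j == 0) :> nat) -> table_ok [::] f.
Proof.
move=> fE; have Z0 : 0 < Z by rewrite muln_gt0 NP_gt0 expn_gt0 B_gt0.
have i0 : idx 0 0 = 0 by rewrite /idx mod0n muln0.
have slot0 j : slot 0 j = 0 by rewrite /slot /dig div0n mod0n.
have nu0 : ~~ use 0 0 by rewrite /use mod0n.
have e0 : entry f 0 0 by split; [rewrite expn_gt0 n_gt0|rewrite expn_gt0 B_gt0|rewrite i0 fE // div0n].
split=> [j /fE->|P H [Pc Hh]|p Hm [-> ->]]; first by case: eqP.
  rewrite fE ?idx_lt //; case: eqP => //= E [D].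
  have [-> ->] : P = 0 /\ H = 0 by apply: idx_inj; rewrite ?i0 // -D div0n.
  split=> //; first by split=> [|k kc _]; rewrite ?dig0 // expn_gt0 n_gt0.
  - by rewrite expn_gt0 B_gt0.
  - move=> U uU hU; exists (fun=> 0), [::]; split=> //; split=> //.
    case: U uU hU => // y U _ /(_ y); rewrite inE eqxx => /(_ isT) [j jh [_]].
    by rewrite slot0 (negbTE nu0).
exists 0, 0; split=> //; split=> // [j jh|i j ih jh]; rewrite slot0 (negbTE nu0) //.
Qed.

(** Any hand may remain at the end, hence the quantifier over [H]. The condition on [seen] has
    content for n = 1, where every digit is maximal from the start. *)
Lemma winnable_table deck f : table_ok (rev deck) f ->
  winnable h n c deck <->
  (exists2 H, H < B ^ h & f ((n ^ c.-1).-1 + n ^ c.-1 * H) = n) /\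
  (forall k, k < c -> seen (rev deck) k).
Proof.
move=> [fn ok cpl]; rewrite winnable_drawn.
have idx_max H : idx (n ^ c).-1 H = (n ^ c.-1).-1 + n ^ c.-1 * H.
  congr (_ + _); have -> : (n ^ c).-1 = n.-1 * n ^ c.-1 + (n ^ c.-1).-1.
    by rewrite ncE; move: NP_gt0 n_gt0; case: (n ^ c.-1) => // N; case: (n) => // m; nia.
  by rewrite modnMDl modn_small // prednK.
have div_max : (n ^ c).-1 %/ n ^ c.-1 = n.-1.
  have -> : (n ^ c).-1 = n.-1 * n ^ c.-1 + (n ^ c.-1).-1.
    by rewrite ncE; move: NP_gt0 n_gt0; case: (n ^ c.-1) => // N; case: (n) => // m; nia.
  by rewrite divnMDl // divn_small ?addn0 // prednK.
have nc_gt0 : 0 < n ^ c by rewrite expn_gt0 n_gt0.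
have nc_pred : (n ^ c).-1 < n ^ c by rewrite prednK.
split=> [[p [Hm [/cpl [P [H [[Pc Hh e] [Dp _ _ _]]]] W]]]|[[H Hh e] sn]].
  have full k : k < c -> seen (rev deck) k /\ dig n k P = n.-1.
    move=> kc; have := Dp k kc; rewrite W // /val; have := dig_lt k P n_gt0.
    by case: (seen _ _); [split=> //; lia | lia].
  have PE := (max_digits n_gt0 Pc).1 (fun k kc => (full k kc).2).
  split; last by move=> k /full [].
  by exists H => //; rewrite -idx_max -PE e PE div_max prednK.
have [_ _ _ snd] : entry_ok (rev deck) (n ^ c).-1 H.
  by apply: ok; split; rewrite // idx_max e div_max prednK.
(* Only the values matter at the end, so no card has to be left in the hand. *)
have [//|//|p [H' [D [A _]]]] := snd [::].
exists p, H'; split=> // k /andP[k0 kc].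
have kc' : k.-1 < c by lia.
rewrite -[k]prednK // A // /val sn //.
by rewrite ((max_digits n_gt0 nc_pred).2 erefl) // prednK.
Qed.

End Packed.

(** * Structured programs for the word RAM *)

Inductive cmd :=
| Ops of seq instr
| Seq of cmd & cmd
| If of nat & cmd
| While of nat & cmd.

Fixpoint csize (k : cmd) : nat :=
  match k with
  | Ops l => size l
  | Seq k1 k2 => csize k1 + csize k2
  | If _ k => (csize k).+1
  | While _ k => (csize k).+2
  end.

Fixpoint compile (o : nat) (k : cmd) : seq instr :=
  match k with
  | Ops l => l
  | Seq k1 k2 => compile o k1 ++ compile (o + csize k1) k2
  | If r k => IJz r (o + (csize k).+1) :: compile o.+1 k
  | While r k => IJz r (o + (csize k).+2) :: compile o.+1 k ++ [:: IJmp o]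
  end.

Lemma size_compile o k : size (compile o k) = csize k.
Proof.
elim: k o => //= [k1 IH1 k2 IH2|_ k IH|_ k IH] o; first by rewrite size_cat IH1 IH2.
  by rewrite IH.
by rewrite size_cat IH /= addn1.
Qed.

(** * Triples with time, address and word bounds *)

Section Triples.

Variables (inp : seq nat) (S W : nat).
Hypotheses (W_gt0 : 0 < W) (inp_le : forall i, nth 0 inp i <= W).

Implicit Types (R M : nat -> nat) (P : seq instr) (Q : (nat -> nat) -> (nat -> nat) -> Prop).

Definition bounded R M := (forall r, R r <= W) /\ (forall i, M i <= W).

(** [within] and [exec] describe runs up to a halt; partial runs compose, and [runs_halt] converts
    them at the end. *)
Fixpoint runs P (t : nat) (s s' : mstate) : Prop :=
  if t is t'.+1 then
    exists s1 oa, [/\ step P inp s = Some (s1, oa), forall a, oa = Some a -> a < S,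
      bounded (reg s1) (Defs.mem s1) & runs P t' s1 s']
  else s = s'.

Lemma runs_add P t1 t2 s1 s2 s3 :
  runs P t1 s1 s2 -> runs P t2 s2 s3 -> runs P (t1 + t2) s1 s3.
Proof.
elim: t1 s1 => [|t1 IH] s1 /=; first by move=> ->.
by case=> s [oa [E a b r]] r2; exists s, oa; split=> //; apply: IH.
Qed.

Lemma runs_halt P t T s s' : runs P t s s' -> step P inp s' = None -> t <= T ->
  within P inp T S W s /\ exec P inp T s = Some s'.
Proof.
elim: t T s => [|t IH] [|T] s //=; try by move=> -> ->.
case=> s1 [oa [-> a [b1 b2] r]] N tT.
by have [w e] := IH T s1 r N tT; split.
Qed.

Definition code_at P o l := forall i, i < size l ->
  o + i < size P /\ nth IHalt P (o + i) = nth IHalt l i.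

Lemma code_at_cat P o l1 l2 :
  code_at P o (l1 ++ l2) -> code_at P o l1 /\ code_at P (o + size l1) l2.
Proof.
move=> C; split=> i il.
  by have := C i; rewrite size_cat nth_cat il; apply; rewrite ltn_addr.
have := C (size l1 + i); rewrite size_cat nth_cat ltn_add2l addnA => /(_ il).
by rewrite [_ < size l1]ltnNge leq_addr addKn.
Qed.

Lemma code_at_cons P o i l :
  code_at P o (i :: l) -> [/\ o < size P, nth IHalt P o = i & code_at P o.+1 l].
Proof.
move=> C; have [C1 C2] := @code_at_cat P o [:: i] l C.
have := C1 0 isT; rewrite addn0 => -[oP E]; split=> //.
by move: C2; rewrite addn1.
Qed.

(** The precondition is one concrete state, so register contents are found by computation and a
    postcondition may itself be a triple, as in [tri_seq]. Quantifying over [o] makes triples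
    independent of the position of the code. *)
Definition tri k (t : nat) R M Q := bounded R M -> forall P o, code_at P o (compile o k) ->
  exists t' R' M', [/\ t' <= t, runs P t' (MSt o R M) (MSt (o + csize k) R' M'),
    bounded R' M' & Q R' M'].

Lemma tri_leq k t t' R M Q : t' <= t -> tri k t' R M Q -> tri k t R M Q.
Proof.
move=> tt T b P o C; have [u [R' [M' [ut r b' q]]]] := T b P o C.
by exists u, R', M'; split=> //; apply: leq_trans tt.
Qed.

Lemma tri_seq k1 k2 t1 t2 R M Q :
  tri k1 t1 R M (fun R M => tri k2 t2 R M Q) -> tri (Seq k1 k2) (t1 + t2) R M Q.
Proof.
move=> T b P o /= /code_at_cat; rewrite size_compile => -[C1 C2].
have [u1 [R1 [M1 [ut1 r1 b1 T2]]]] := T b P o C1.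
have [u2 [R2 [M2 [ut2 r2 b2 q]]]] := T2 b1 P _ C2.
exists (u1 + u2), R2, M2; split=> //; first exact: leq_add.
by rewrite addnA; apply: runs_add r1 r2.
Qed.

Lemma tri_if r k t R M Q :
  (R r != 0 -> tri k t R M Q) -> (R r = 0 -> Q R M) -> tri (If r k) t.+1 R M Q.
Proof.
move=> T F b P o /= /code_at_cons [oP on C].
have [R0|R0] := eqVneq (R r) 0.
  exists 1, R, M; split=> //; last exact: F.
  by exists (MSt (o + (csize k).+1) R M), None; rewrite /step /= oP on R0.
have [u [R1 [M1 [ut r1 b1 q]]]] := T R0 b P _ C.
exists u.+1, R1, M1; split=> //; exists (MSt o.+1 R M), None.
by split; rewrite // /step /= ?oP ?on ?(negbTE R0) // -addSnnS.
Qed.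

(** The invariant is indexed by the number of iterations left, which also serves as the variant.
    Each iteration pays for a test and a jump besides the body, and the failing last test gives the
    final successor. *)
Lemma tri_while r k tb (I : nat -> (nat -> nat) -> (nat -> nat) -> Prop) m R M Q :
  (forall i R M, I i.+1 R M -> R r != 0 /\ tri k tb R M (I i)) ->
  (forall R M, I 0 R M -> R r = 0 /\ Q R M) -> I m R M ->
  tri (While r k) (m * tb.+2).+1 R M Q.
Proof.
move=> body exit Im b P o /= /code_at_cons [oP on C].
have [C1 C2] := code_at_cat C; rewrite size_compile in C2.
have [oP2 on2 _] := code_at_cons C2.
elim: m R M Im b => [|m IH] R M Im b.
  have [R0 q] := exit R M Im; exists 1, R, M; split=> //.
  by exists (MSt (o + (csize k).+2) R M), None; rewrite /step /= oP on R0.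
have [R0 T] := body m R M Im.
have [u1 [R1 [M1 [ut1 r1 b1 Im1]]]] := T b P _ C1.
have [u2 [R2 [M2 [ut2 r2 b2 q]]]] := IH R1 M1 Im1 b1.
exists (u1 + u2.+1).+1, R2, M2; split=> //; first by rewrite mulSn; lia.
exists (MSt o.+1 R M), None; split; rewrite // /step /= ?oP ?on ?(negbTE R0) //.
apply: runs_add r1 _; exists (MSt o R1 M1), None.
by split=> //; rewrite /step /= oP2 on2.
Qed.

(* Every value computed gets a name [w], so that the state stays a readable chain
   of updates; only additions, products and constants can exceed the word bound. *)
Definition wpi (i : instr) R M Q : Prop :=
  let set r v := forall w, w = v -> Q (fupd R r w) M in
  match i with
  | IConst r v => v <= W /\ set r v
  | IAdd r a b => R a + R b <= W /\ set r (R a + R b)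
  | ISub r a b => set r (R a - R b)
  | IMul r a b => R a * R b <= W /\ set r (R a * R b)
  | IDiv r a b => set r (R a %/ R b)
  | IMod r a b => set r (R a %% R b)
  | ILt r a b => set r (nat_of_bool (R a < R b))
  | IEq r a b => set r (nat_of_bool (R a == R b))
  | IReadIn r a => set r (nth 0 inp (R a))
  | ILoad r a => R a < S /\ set r (M (R a))
  | IStore a b => R a < S /\ Q R (fupd M (R a) (R b))
  | _ => False
  end.

Fixpoint wps (l : seq instr) R M Q : Prop :=
  if l is i :: l' then wpi i R M (fun R M => wps l' R M Q) else Q R M.

Lemma wps_cat l1 l2 R M Q :
  wps l1 R M (fun R M => wps l2 R M Q) -> wps (l1 ++ l2) R M Q.
Proof.
elim: l1 R M => //= i l1 IH R M.
by case: i => //= *; try (split; [tauto|]); try (move=> w wE); apply: IH;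
  repeat match goal with H : _ /\ _ |- _ => case: H => ? ? end; auto.
Qed.

Lemma wps_mono l R M Q Q' : (forall R M, Q R M -> Q' R M) -> wps l R M Q -> wps l R M Q'.
Proof.
move=> QQ; elim: l R M => [|i l IH] R M /=; first exact: QQ.
by case: i => //= *; try (split; [tauto|]); try (move=> w wE); apply: IH;
  repeat match goal with H : _ /\ _ |- _ => case: H => ? ? end; auto.
Qed.

Lemma bounded_reg R M r v : bounded R M -> v <= W -> bounded (fupd R r v) M.
Proof. by move=> [bR bM] vW; split=> // j; rewrite /fupd; case: eqP. Qed.

Lemma bounded_mem R M a v : bounded R M -> v <= W -> bounded R (fupd M a v).
Proof. by move=> [bR bM] vW; split=> // j; rewrite /fupd; case: eqP. Qed.

Lemma tri_ops l R M Q : wps l R M Q -> tri (Ops l) (size l) R M Q.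
Proof.
elim: l R M => [|i l IH] R M /= wp b P o C.
  by exists 0, R, M; rewrite addn0.
have [oP on C'] := code_at_cons C.
suff [R1 [M1 [oa [E a b1 wp1]]]] : exists R1 M1 oa,
    [/\ step P inp (MSt o R M) = Some (MSt o.+1 R1 M1, oa), forall a, oa = Some a -> a < S,
        bounded R1 M1 & wps l R1 M1 Q].
  have [u [R2 [M2 [ut r b2 q]]]] := IH R1 M1 wp1 b1 P o.+1 C'.
  exists u.+1, R2, M2; split=> //; rewrite addnS.
  by exists (MSt o.+1 R1 M1), oa.
have bool_le (x : bool) : x <= W by case: x.
have [bR bM] := b.
have set r v : v <= W -> (forall w, w = v -> wps l (fupd R r w) M Q) ->
    bounded (fupd R r v) M /\ wps l (fupd R r v) M Q.
  by move=> vW wp'; split; [apply: bounded_reg|apply: wp'].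
move: wp; rewrite /wpi; case: i on {C C'} =>
  [r v|r a a'|r a a'|r a a'|r a a'|r a a'|r a a'|r a a'|r|r a|r a|a a'|||] //= on.
- by case=> vW /(set _ _ vW) [b' w]; do 3 eexists; split; [rewrite /step /= oP on|..|exact: w].
- by case=> vW /(set _ _ vW) [b' w]; do 3 eexists; split; [rewrite /step /= oP on|..|exact: w].
- move=> /(set _ _ (leq_trans (leq_subr _ _) (bR a))) [b' w].
  by do 3 eexists; split; [rewrite /step /= oP on|..|exact: w].
- by case=> vW /(set _ _ vW) [b' w]; do 3 eexists; split; [rewrite /step /= oP on|..|exact: w].
- move=> /(set _ _ (leq_trans (leq_div _ _) (bR a))) [b' w].
  by do 3 eexists; split; [rewrite /step /= oP on|..|exact: w].
- move=> /(set _ _ (leq_trans (leq_mod _ _) (bR a))) [b' w].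
  by do 3 eexists; split; [rewrite /step /= oP on|..|exact: w].
- move=> /(set _ _ (bool_le _)) [b' w].
  by do 3 eexists; split; [rewrite /step /= oP on|..|exact: w].
- move=> /(set _ _ (bool_le _)) [b' w].
  by do 3 eexists; split; [rewrite /step /= oP on|..|exact: w].
- move=> /(set _ _ (inp_le _)) [b' w].
  by do 3 eexists; split; [rewrite /step /= oP on|..|exact: w].
- case=> aS /(set _ _ (bM _)) [b' w].
  by do 3 eexists; split; [by rewrite /step /= oP on|by move=> _ [<-]|..|exact: w].
- case=> aS w; do 3 eexists; split; [by rewrite /step /= oP on|by move=> _ [<-]|..|exact: w].
  exact: bounded_mem.
Qed.

End Triples.

(** * The program *)

(* Registers:
   0, 1: the constants 0 and 1;  2, 3, 4: h, n, c;  6: n c;  7: (n c)^h;  8: n^(c-1);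
   9: number of cells;  10: cards left;  11: input pointer;  12, 13: current and next
   table;  14: code of the card drawn;  15: its color;  16: cell counter;  17: H;
   18 and above: scratch, with 22 holding P, 23 a card or the hand to be written,
   20 and 21 the weight of the current slot and the number of slots left.
   The memory cell k < c contains n^k once the 1 of color k was drawn, and 0 before;
   the two tables follow. *)
Definition slot_code := [:: IDiv 23 17 20; IMod 23 23 6].

(** Free of branches: the word loaded for the color is 0 if the color is unseen, so it is at once
    the weight of the digit and the flag [sn]. *)
Definition play_code :=
  [:: IMod 24 23 3; IDiv 25 23 3; ILoad 25 25; IDiv 26 22 25; IMod 26 26 3;
      IAdd 26 26 1; IEq 26 24 26; IMul 26 26 25; IAdd 22 22 26].

(** The maximum of the old and the new content is the truncated difference plus the old content. *)
Definition write_code :=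
  [:: IMod 24 22 8; IMul 25 8 23; IAdd 24 24 25; IAdd 24 24 13; IDiv 25 22 8;
      IAdd 25 25 1; ILoad 26 24; ISub 25 25 26; IAdd 25 25 26; IStore 24 25].

(** The comparison yields 1 exactly when the slot is free, and multiplies both the new and the old
    digit; for a useful slot the result is [H] itself. *)
Definition replace_code :=
  [:: IMod 24 23 3; IDiv 25 23 3; ILoad 25 25; IDiv 26 22 25; IMod 26 26 3;
      IAdd 26 26 1; ILt 26 24 26; IMul 27 26 23; IMul 27 27 20;
      IMul 26 26 14; IMul 26 26 20; IAdd 26 17 26; ISub 23 26 27].

Definition next_slot := [:: IMul 20 20 6; ISub 21 21 1].

Definition for_slots (body : seq instr) :=
  Seq (Ops [:: IConst 20 1; IAdd 21 2 0]) (While 21 (Ops (body ++ next_slot))).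

Definition scan_cmd := for_slots (slot_code ++ play_code).

Definition close_cmd :=
  Seq (Ops [:: IAdd 19 2 0]) (While 19 (Seq scan_cmd (Ops [:: ISub 19 19 1]))).

Definition store_cmd := for_slots (slot_code ++ replace_code ++ write_code).

(** The first store resets the cell just read. The current table is thus empty after the pass and
    can receive the next layer but one, without a separate clearing loop. *)
Definition entry_cmd :=
  Seq (Ops ([:: IStore 28 0; IMod 22 16 8; ISub 29 29 1; IMul 29 29 8; IAdd 22 22 29;
              IDiv 17 16 8; IAdd 23 14 0] ++ play_code))
  (Seq close_cmd (Seq (Ops (IAdd 23 17 0 :: write_code)) store_cmd)).

Definition cell_cmd :=
  Seq (Ops [:: ISub 16 16 1; IAdd 28 12 16; ILoad 29 28]) (If 29 entry_cmd).

Definition pow_cmd :=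
  Seq (Ops [:: IConst 20 1]) (While 21 (Ops [:: IMul 20 20 22; ISub 21 21 1])).

(** The power of n for the color is recomputed for each card in time O(c), which the bound absorbs.
    The mark of the color is updated by a maximum, so an earlier mark survives. *)
Definition layer_cmd :=
  Seq (Ops [:: IReadIn 14 11; ISub 14 14 1; IAdd 11 11 1; IReadIn 15 11; ISub 15 15 1;
            IAdd 11 11 1; IAdd 22 3 0; IAdd 21 15 0])
  (Seq pow_cmd
  (Seq (Ops [:: IEq 16 14 0; IMul 16 16 20; ILoad 17 15; ISub 16 16 17; IAdd 16 16 17;
            IStore 15 16; IMul 16 3 15; IAdd 14 14 16; IAdd 16 9 0])
  (Seq (While 16 cell_cmd)
       (Ops [:: IAdd 22 12 0; IAdd 12 13 0; IAdd 13 22 0; ISub 10 10 1])))).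

(** The winning cells lie n^(c-1) apart, one per hand. Register 19 counts those that contain n and
    is annulled if some color was never started. *)
Definition final_cmd :=
  Seq (Ops [:: IConst 19 0; IAdd 21 7 0; ISub 22 8 1; IAdd 22 22 12])
  (Seq (While 21 (Ops [:: ILoad 23 22; IEq 23 23 3; IAdd 19 19 23; IAdd 22 22 8; ISub 21 21 1]))
  (Seq (Ops [:: IAdd 21 4 0])
  (Seq (While 21 (Ops [:: ISub 21 21 1; ILoad 23 21; ILt 23 0 23; IMul 19 19 23]))
       (Ops [:: IAdd 0 19 0])))).

Definition main_cmd :=
  Seq (Ops [:: IReadIn 2 0; IReadIn 3 1; IConst 22 2; IReadIn 4 22; IConst 11 4;
            IMul 6 3 4; IAdd 22 6 0; IAdd 21 2 0])
  (Seq pow_cmd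
  (Seq (Ops [:: IAdd 7 20 0; IAdd 22 3 0; ISub 21 4 1])
  (Seq pow_cmd
  (Seq (Ops [:: IAdd 8 20 0; IMul 9 8 7; IAdd 12 4 0; IAdd 13 12 9; IStore 12 1])
  (Seq (While 10 layer_cmd) final_cmd))))).

(** For an empty deck only constant time is allowed, so even the initial powers must be skipped;
    register 0 then still contains 0, the right answer. *)
Definition hanabi_cmd :=
  Seq (Ops [:: IConst 1 1; IConst 10 3; IReadIn 10 10]) (If 10 main_cmd).

(** Inner loops use higher registers than outer ones, so a single threshold describes what a piece
    of code preserves. *)
Definition frame (m : nat) (R R' : nat -> nat) := forall r, r < m -> R' r = R r.

Lemma frame_refl m R : frame m R R. Proof. by []. Qed.

Lemma frame_fupd m R R' i v : m <= i -> frame m R R' -> frame m R (fupd R' i v).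
Proof. by move=> mi F r rm; rewrite /fupd F //; case: eqP => // E; lia. Qed.

Lemma frame_trans m1 m2 R R1 R2 : m1 <= m2 -> frame m1 R R1 -> frame m2 R1 R2 -> frame m1 R R2.
Proof. by move=> m12 F1 F2 r rm; rewrite F2 ?F1 // (leq_trans rm). Qed.

Lemma fupdE f i v j : fupd f i v j = if j == i then v else f j. Proof. by []. Qed.

(** * Symbolic execution of straight-line code *)

Section Wps.

Variables (inp : seq nat) (S W : nat) (l : seq instr) (R M : nat -> nat).
Variable (Q : (nat -> nat) -> (nat -> nat) -> Prop).

Lemma wps_const r v : v <= W ->
  wps inp S W l (fupd R r v) M Q -> wps inp S W (IConst r v :: l) R M Q.
Proof. by move=> vW q; split=> // w ->. Qed.

Lemma wps_add r a b va vb : R a = va -> R b = vb -> va + vb <= W ->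
  (forall w, w = va + vb -> wps inp S W l (fupd R r w) M Q) -> wps inp S W (IAdd r a b :: l) R M Q.
Proof. by move=> <- <- vW q. Qed.

Lemma wps_sub r a b va vb : R a = va -> R b = vb ->
  (forall w, w = va - vb -> wps inp S W l (fupd R r w) M Q) -> wps inp S W (ISub r a b :: l) R M Q.
Proof. by move=> <- <- q. Qed.

Lemma wps_mul r a b va vb : R a = va -> R b = vb -> va * vb <= W ->
  (forall w, w = va * vb -> wps inp S W l (fupd R r w) M Q) -> wps inp S W (IMul r a b :: l) R M Q.
Proof. by move=> <- <- vW q. Qed.

Lemma wps_div r a b va vb : R a = va -> R b = vb ->
  (forall w, w = va %/ vb -> wps inp S W l (fupd R r w) M Q) -> wps inp S W (IDiv r a b :: l) R M Q.
Proof. by move=> <- <- q. Qed.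

Lemma wps_mod r a b va vb : R a = va -> R b = vb ->
  (forall w, w = va %% vb -> wps inp S W l (fupd R r w) M Q) -> wps inp S W (IMod r a b :: l) R M Q.
Proof. by move=> <- <- q. Qed.

Lemma wps_lt r a b va vb : R a = va -> R b = vb ->
  (forall w, w = (va < vb) :> nat -> wps inp S W l (fupd R r w) M Q) ->
  wps inp S W (ILt r a b :: l) R M Q.
Proof. by move=> <- <- q. Qed.

Lemma wps_eq r a b va vb : R a = va -> R b = vb ->
  (forall w, w = (va == vb) :> nat -> wps inp S W l (fupd R r w) M Q) ->
  wps inp S W (IEq r a b :: l) R M Q.
Proof. by move=> <- <- q. Qed.

Lemma wps_read r a va : R a = va ->
  (forall w, w = nth 0 inp va -> wps inp S W l (fupd R r w) M Q) ->
  wps inp S W (IReadIn r a :: l) R M Q.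
Proof. by move=> <- q. Qed.

Lemma wps_load r a va : R a = va -> va < S ->
  (forall w, w = M va -> wps inp S W l (fupd R r w) M Q) ->
  wps inp S W (ILoad r a :: l) R M Q.
Proof. by move=> <- aS q. Qed.

Lemma wps_store a b va vb : R a = va -> R b = vb -> va < S ->
  wps inp S W l R (fupd M va vb) Q -> wps inp S W (IStore a b :: l) R M Q.
Proof. by move=> <- <- aS q. Qed.

End Wps.

Ltac look := rewrite ?fupdE /=;
  lazymatch goal with
  | |- ?x = _ =>
    first [is_var x; reflexivity | match goal with E : x = _ |- _ => exact: E end | reflexivity]
  end.

Ltac instr :=
  cbv beta delta [next_slot slot_code play_code replace_code write_code];
  lazymatch goal with
  | |- wps _ _ _ (IConst _ _ :: _) _ _ _ => apply: wps_const
  | |- wps _ _ _ (IAdd _ _ _ :: _) _ _ _ => eapply wps_add; [look|look| |]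
  | |- wps _ _ _ (ISub _ _ _ :: _) _ _ _ => eapply wps_sub; [look|look|]
  | |- wps _ _ _ (IMul _ _ _ :: _) _ _ _ => eapply wps_mul; [look|look| |]
  | |- wps _ _ _ (IDiv _ _ _ :: _) _ _ _ => eapply wps_div; [look|look|]
  | |- wps _ _ _ (IMod _ _ _ :: _) _ _ _ => eapply wps_mod; [look|look|]
  | |- wps _ _ _ (ILt _ _ _ :: _) _ _ _ => eapply wps_lt; [look|look|]
  | |- wps _ _ _ (IEq _ _ _ :: _) _ _ _ => eapply wps_eq; [look|look|]
  | |- wps _ _ _ (IReadIn _ _ :: _) _ _ _ => eapply wps_read; [look|]
  | |- wps _ _ _ (ILoad _ _ :: _) _ _ _ => eapply wps_load; [look| |]
  | |- wps _ _ _ (IStore _ _ :: _) _ _ _ => eapply wps_store; [look|look| |]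
  end.

Ltac framed := repeat (apply: frame_fupd; first by []); apply: frame_refl.

(** * Correctness of the pieces of the program *)

Section Correct.

Variables (h n c N : nat) (inp : seq nat) (S W : nat).
Hypotheses (h_gt0 : 0 < h) (n_gt0 : 0 < n) (c_gt0 : 0 < c).

Local Notation B := (n * c).
Local Notation BH := ((n * c) ^ h).
Local Notation NP := (n ^ c.-1).
Local Notation Z := (n ^ c.-1 * (n * c) ^ h).

(** [n ^ c] bounds [P]; [2 * (B * BH)] bounds the sum formed by [replace_code] before the old digit
    is subtracted; the multiple of [Z] covers the addresses, and [2 * N + 6] the input pointer and
    the small constants. *)
Hypothesis W_ge : n ^ c + 2 * (B * BH) + 4 * Z + B + c + n + h + 2 * N + 6 <= W.
Hypothesis S_ge : c + 2 * Z <= S.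
Hypothesis inp_le : forall i, nth 0 inp i <= W.

Let B_gt0 : 0 < B. Proof. by rewrite muln_gt0 n_gt0. Qed.
Let BH_gt0 : 0 < BH. Proof. by rewrite expn_gt0 B_gt0. Qed.
Let NP_gt0 : 0 < NP. Proof. by rewrite expn_gt0 n_gt0. Qed.
Let Z_gt0 : 0 < Z. Proof. by rewrite muln_gt0 NP_gt0. Qed.
Let W_gt0 : 0 < W. Proof. by apply: leq_trans W_ge; rewrite addnS. Qed.
Let ncE : n ^ c = n * NP. Proof. by rewrite -expnS prednK. Qed.
Let BH_le : BH <= Z. Proof. by rewrite leq_pmull. Qed.
Let NP_le : NP <= Z. Proof. by rewrite leq_pmulr. Qed.
Let nc_W : n ^ c <= W. Proof. by move: W_ge; clear; lia. Qed.
Let BBH_W : 2 * (B * BH) <= W. Proof. by move: W_ge; clear; lia. Qed.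
Let BH_W : BH <= W. Proof. by move: BH_le W_ge; clear; lia. Qed.
Let NP_W : NP <= W. Proof. by move: NP_le W_ge; clear; lia. Qed.
Let cZ_W : c + 3 * Z <= W. Proof. by move: W_ge; clear; lia. Qed.
Let B_W : B <= W. Proof. by move: W_ge; clear; lia. Qed.
Let n_W : n <= W. Proof. by move: W_ge; clear; lia. Qed.
Let c_W : c <= W. Proof. by move: W_ge; clear; lia. Qed.
Let h_W : h <= W. Proof. by move: W_ge; clear; lia. Qed.
Let c_S : c <= S. Proof. by move: S_ge; clear; lia. Qed.

Definition consts (R : nat -> nat) :=
  [/\ [/\ R 0 = 0, R 1 = 1, R 2 = h & R 3 = n] &
      [/\ R 4 = c, R 6 = B, R 7 = BH, R 8 = NP & R 9 = Z]].

Lemma consts_frame m R R' : frame m R R' -> 9 < m -> consts R -> consts R'.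
Proof.
move=> F m9 [[? ? ? ?] [? ? ? ? ?]].
by split; split; rewrite F //; apply: leq_trans m9.
Qed.

Definition pows (M : nat -> nat) (sn : nat -> bool) := forall k, k < c -> M k = sn k * n ^ k.

(* Division by [M k = 0] makes the digit of an unseen color [0]. *)
Lemma dig_pows sn P k : k < c -> wf n c sn P -> P %/ (sn k * n ^ k) %% n = dig n k P.
Proof.
move=> kc [_ P0]; have := P0 k kc; case: (sn k) => [_|->//]; first by rewrite mul1n.
by rewrite mul0n divn0 mod0n.
Qed.

Lemma wps_slot R M Q H j : R 6 = B -> R 17 = H -> R 20 = B ^ j ->
  (forall R', frame 23 R R' -> R' 23 = slot n c H j -> Q R' M) ->
  wps inp S W slot_code R M Q.
Proof.
move=> R6 R17 R20 q; rewrite /slot_code.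
instr => v1 E1; instr => v2 E2; apply: q; first by framed.
by rewrite fupdE /= E2 E1.
Qed.

Lemma wps_play R M Q sn P g : R 1 = 1 -> R 3 = n -> R 22 = P -> R 23 = g ->
  pows M sn -> wf n c sn P -> g %/ n < c ->
  (forall R', frame 22 R R' -> R' 22 = play n sn P g -> Q R' M) ->
  wps inp S W play_code R M Q.
Proof.
move=> R1 R3 R22 R23 pM wfP gc q; rewrite /play_code.
instr => v1 E1; instr => v2 E2; instr => [|v3 E3]; first by rewrite E2; apply: leq_trans gc c_S.
instr => v4 E4; instr => v5 E5.
have v5n : v5 < n by rewrite E5 ltn_mod.
instr => [|v6 E6]; first by rewrite addn1; apply: leq_trans v5n n_W.
instr => v7 E7.
have v3E : v3 = sn v2 * n ^ v2 by rewrite E3 pM // E2.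
have v5E : v5 = dig n v2 P by rewrite E5 E4 v3E dig_pows // E2.
have playE : P + v7 * v3 = play n sn P g.
  by rewrite E7 E6 E1 v3E v5E /play addn1 -E2; case: (sn v2); rewrite ?mul1n // muln0.
have [lt_nc _] := wf_play n_gt0 gc wfP.
have playW := leq_trans (ltnW lt_nc) nc_W; rewrite -playE in playW.
instr => [|v8 E8]; first exact: leq_trans (leq_addl _ _) playW.
instr => [|v9 E9]; first by rewrite E8.
apply: q; first by framed.
by rewrite fupdE /= E9 E8.
Qed.

(** The invariant mentions only register 22 and the memory, since the other registers written by a
    body are scratch. Register 21 counts down, so the current slot is h minus its content. *)
Lemma tri_for_slots body R M Q (I : nat -> nat -> (nat -> nat) -> Prop) :
  consts R -> I 0 (R 22) M ->
  (forall R' M' j, j < h -> consts R' -> frame 20 R R' -> R' 20 = B ^ j -> I j (R' 22) M' ->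
    wps inp S W body R' M' (fun R2 M2 => frame 22 R' R2 /\ I j.+1 (R2 22) M2)) ->
  (forall R' M', frame 20 R R' -> I h (R' 22) M' -> Q R' M') ->
  tri inp S W (for_slots body) (h * (size body + 4) + 3) R M Q.
Proof.
move=> cR I0 step q; have [[R0 R1 R2 R3] [R4 R6 R7 R8 R9]] := cR.
have -> : h * (size body + 4) + 3 = 2 + (h * (size (body ++ next_slot)).+2).+1.
  by rewrite size_cat /=; lia.
apply: tri_seq; apply: (tri_ops W_gt0 inp_le).
instr; first exact: W_gt0.
instr => [|v E]; first by rewrite addn0.
apply: (tri_while W_gt0 (I := fun i R' M' => [/\ i <= h, frame 20 R R', R' 21 = i,
  R' 20 = B ^ (h - i) & I (h - i) (R' 22) M'])).
- move=> i R' M' [ih F R'21 R'20 IM]; split; first by rewrite R'21.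
  apply: (tri_ops W_gt0 inp_le); apply: wps_cat.
  have cR' := consts_frame F isT cR.
  have j_lt : h - i.+1 < h by move: ih; clear; lia.
  apply: wps_mono (step _ _ _ j_lt cR' F R'20 IM) => R'' M'' [F' IM'].
  have [[S0 S1 S2 S3] [S4 S6 S7 S8 S9]] := consts_frame F' isT cR'.
  have S20 : R'' 20 = B ^ (h - i.+1) by rewrite F'.
  have S21 : R'' 21 = i.+1 by rewrite F'.
  have jE : h - i = (h - i.+1).+1 by move: ih; clear; lia.
  have pw_le : B ^ (h - i) <= BH by rewrite leq_pexp2l // leq_subr.
  instr => [|v20 E20]; first by rewrite -expnSr -jE; apply: leq_trans pw_le BH_W.
  instr => v21 E21; split; first exact: ltnW.
  + by apply: (frame_trans (m2 := 20)) F _ => //; apply: (frame_trans (m2 := 20));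
      [| |framed] => // r r20; apply: F'; move: r20; clear; lia.
  + by rewrite !fupdE /= E21 subn1.
  + by rewrite !fupdE /= E20 -expnSr jE.
  + by rewrite !fupdE /= jE.
- move=> R' M' [_ F R'21 _ IM]; split=> //; apply: q => //.
  by rewrite subn0 in IM.
- split; rewrite ?fupdE //= ?subnn ?expn0 //; first by framed.
  by rewrite E addn0.
Qed.

Lemma foldl_iota_rcons T (f : T -> nat -> T) z k :
  foldl f z (iota 0 k.+1) = f (foldl f z (iota 0 k)) k.
Proof. by rewrite -addn1 iotaD foldl_cat. Qed.

Lemma tri_scan R M Q sn H P : consts R -> R 17 = H -> R 22 = P -> pows M sn -> wf n c sn P ->
  (forall R', frame 20 R R' -> R' 22 = scan h n c sn H P -> Q R' M) ->
  tri inp S W scan_cmd (h * 15 + 3) R M Q.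
Proof.
move=> cR R17 R22 pM wfP q.
pose fold k := foldl (fun P j => play n sn P (slot n c H j)) P (iota 0 k).
have wf_fold k : wf n c sn (fold k).
  by elim: k => // k IH; rewrite /fold foldl_iota_rcons; apply: wf_play => //; apply: slot_div.
rewrite -[15]/(size (slot_code ++ play_code) + 4).
apply: (tri_for_slots (I := fun j P' M' => P' = fold j /\ M' = M)) => //.
- move=> R' M' j jh [[S0 S1 S2 S3] [S4 S6 S7 S8 S9]] F S20 [S22 ->].
  apply: wps_cat; apply: (wps_slot (H := H) S6 _ S20) => [|R2 F2 R2_23]; first by rewrite F.
  apply: (wps_play (sn := sn) (P := fold j) (g := slot n c H j)) => //; rewrite ?F2 //.
    exact: slot_div.
  move=> R3 F3 R3_22; split; last by rewrite R3_22 /fold foldl_iota_rcons.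
  by apply: frame_trans F3 => // r r22; apply: F2; move: r22; clear; lia.
- by move=> R' M' F [R'22 ->]; apply: q.
Qed.

Lemma tri_close R M Q sn H P : consts R -> R 17 = H -> R 22 = P -> pows M sn -> wf n c sn P ->
  (forall R', frame 19 R R' -> R' 22 = close h n c sn H P -> Q R' M) ->
  tri inp S W close_cmd (h * (h * 15 + 6) + 2) R M Q.
Proof.
move=> cR R17 R22 pM wfP q; have [[R0 R1 R2 R3] [R4 R6 R7 R8 R9]] := cR.
have -> : h * (h * 15 + 6) + 2 = 1 + (h * (h * 15 + 3 + 1).+2).+1 by clear; lia.
apply: tri_seq; apply: (tri_ops W_gt0 inp_le).
instr => [|v E]; first by rewrite addn0.
apply: (tri_while W_gt0 (I := fun i R' M' => [/\ i <= h, frame 19 R R', R' 19 = i, M' = M &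
  R' 22 = iter (h - i) (scan h n c sn H) P])).
- move=> i R' M' [ih F R'19 -> R'22]; split; first by rewrite R'19.
  have cR' := consts_frame F isT cR.
  apply: tri_seq; apply: (tri_scan (sn := sn) (H := H) cR' _ R'22) => //; first by rewrite F.
    exact: wf_iter_scan.
  move=> R'' F' R''22; apply: (tri_ops W_gt0 inp_le).
  have [[S0 S1 S2 S3] [S4 S6 S7 S8 S9]] := consts_frame F' isT cR'.
  have S19 : R'' 19 = i.+1 by rewrite F'.
  instr => v19 E19; split=> //; first exact: ltnW.
  + by apply: (frame_trans (m2 := 19)) F _ => //; apply: (frame_trans (m2 := 19));
      [| |framed] => // r r20; apply: F'; move: r20; clear; lia.
  + by rewrite !fupdE /= E19 subn1.
  + by rewrite !fupdE /= R''22 (_ : h - i = (h - i.+1).+1) //; move: ih; clear; lia.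
- move=> R' M' [_ F R'19 -> R'22]; split=> //; apply: q => //.
  by rewrite R'22 subn0.
- split; rewrite ?fupdE //= ?subnn //; first by framed.
  by rewrite E addn0.
Qed.

Lemma wps_replace R M Q sn P H j x : R 1 = 1 -> R 3 = n -> R 14 = x -> R 17 = H ->
  R 20 = B ^ j -> R 22 = P -> R 23 = slot n c H j -> pows M sn -> wf n c sn P ->
  x < B -> j < h -> H < BH ->
  (forall R', frame 23 R R' ->
    R' 23 = (if use n P (slot n c H j) then H else setd B j H x) -> Q R' M) ->
  wps inp S W replace_code R M Q.
Proof.
move=> R1 R3 R14 R17 R20 R22 R23 pM wfP xB jh HB q; rewrite /replace_code.
set g := slot n c H j in R23 q.
have gc : g %/ n < c by apply: slot_div.
have gB : g < B by apply: dig_lt.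
have gH : g * B ^ j <= H by apply: dig_mul_le.
have jB : B ^ j <= BH by rewrite leq_pexp2l // ltnW.
instr => v1 E1; instr => v2 E2; instr => [|v3 E3]; first by rewrite E2; apply: leq_trans gc c_S.
instr => v4 E4; instr => v5 E5.
have v5n : v5 < n by rewrite E5 ltn_mod.
instr => [|v6 E6]; first by rewrite addn1; apply: leq_trans v5n n_W.
instr => v7 E7.
have v5E : v5 = dig n v2 P by rewrite E5 E4 E3 pM ?dig_pows // E2.
have v7E : v7 = ~~ use n P g :> nat by rewrite E7 E6 E1 v5E /use -E2 addn1 ltnS -leqNgt.
have f1 (b : bool) m : b * m <= m by case: b; rewrite ?mul1n.
have fg := f1 (~~ use n P g) g; have fgj := f1 (~~ use n P g) (g * B ^ j).
have fx := f1 (~~ use n P g) x; have fxj := f1 (~~ use n P g) (x * B ^ j).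
have xj : x * B ^ j <= B * BH by apply: leq_mul => //; apply: ltnW.
rewrite -v7E !mulnA in fg fgj fx fxj.
have sumW : H + v7 * x * B ^ j <= W.
  apply: leq_trans (leq_add (ltnW HB) (leq_trans fxj xj)) _.
  by apply: leq_trans BBH_W; rewrite mul2n -addnn leq_add2r leq_pmull.
instr => [|v8 E8]; first by apply: leq_trans fg (leq_trans (ltnW gB) B_W).
instr => [|v9 E9].
  by rewrite E8; apply: leq_trans fgj (leq_trans gH (leq_trans (ltnW HB) BH_W)).
instr => [|v10 E10]; first by apply: leq_trans fx (leq_trans (ltnW xB) B_W).
instr => [|v11 E11]; first by rewrite E10; apply: leq_trans sumW; apply: leq_addl.
instr => [|v12 E12]; first by rewrite E11 E10.
instr => v13 E13; apply: q; first by framed.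
rewrite fupdE /= E13 E12 E11 E10 E9 E8 v7E.
by case: (use n P g) => /=; rewrite ?mul0n ?addn0 ?subn0 ?mul1n.
Qed.

Lemma wps_write R M Q A P H : R 1 = 1 -> R 8 = NP -> R 13 = A -> R 22 = P -> R 23 = H ->
  P < n ^ c -> H < BH -> A + Z <= c + 2 * Z -> M (A + idx n c P H) <= n ->
  (forall R', frame 23 R R' ->
    Q R' (fupd M (A + idx n c P H) (maxn (M (A + idx n c P H)) (P %/ NP).+1))) ->
  wps inp S W write_code R M Q.
Proof.
move=> R1 R8 R13 R22 R23 Pc HB AZ Mn q; rewrite /write_code.
have iZ : idx n c P H < Z by apply: idx_lt.
have Pd : P %/ NP < n by apply: div_lt.
have NH : NP * H <= Z by rewrite leq_pmul2l // ltnW.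
have AZW : A + Z <= W by apply: leq_trans AZ _; apply: leq_trans cZ_W; rewrite leq_add2l leq_pmul2r.
have addrW : A + idx n c P H <= W by apply: leq_trans AZW; rewrite leq_add2l ltnW.
instr => v1 E1; instr => [|v2 E2].
  by apply: leq_trans NH _; apply: leq_trans AZW; rewrite leq_addl.
have iE : v1 + v2 = idx n c P H by rewrite E1 E2.
instr => [|v3 E3]; first by rewrite iE; apply: leq_trans addrW; apply: leq_addl.
instr => [|v4 E4]; first by rewrite E3 iE addnC.
have v4E : v4 = A + idx n c P H by rewrite E4 E3 iE addnC.
have v4S : v4 < S.
  by rewrite v4E; apply: leq_trans S_ge; apply: leq_trans AZ; rewrite ltn_add2l.
instr => v5 E5; instr => [|v6 E6]; first by rewrite E5 addn1; apply: leq_trans Pd n_W.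
instr => [|v7 E7]; first exact: v4S.
have v7E : v7 = M (A + idx n c P H) by rewrite E7 v4E.
instr => v8 E8.
have maxE : v8 + v7 = maxn (M (A + idx n c P H)) (P %/ NP).+1.
  by rewrite maxnE E8 v7E E6 E5 addn1 addnC.
instr => [|v9 E9].
  by rewrite maxE geq_max (leq_trans Mn n_W) (leq_trans Pd n_W).
instr; first exact: v4S.
rewrite E9 maxE.
by rewrite v4E; apply: q; framed.
Qed.

Definition outside A (M M' : nat -> nat) := forall a, ~~ (A <= a < A + Z) -> M' a = M a.

Lemma outside_trans A M1 M2 M3 : outside A M1 M2 -> outside A M2 M3 -> outside A M1 M3.
Proof. by move=> O1 O2 a na; rewrite O2 ?O1. Qed.

Lemma outside_fupd A M j v : j < Z -> outside A M (fupd M (A + j) v).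
Proof. by move=> jZ a na; rewrite fupdE; case: eqP => // E; move: na; rewrite E; lia. Qed.

Definition region A := c <= A /\ A + Z <= c + 2 * Z.

Lemma pows_outside A M M' sn : region A -> outside A M M' -> pows M sn -> pows M' sn.
Proof. by move=> [cA _] O pM k kc; rewrite O ?pM //; lia. Qed.

Definition table A (M : nat -> nat) := fun j => M (A + j).

Lemma files_fupd A M L P H v : files h n c (table A M) L -> P < n ^ c -> H < BH ->
  v = maxn (M (A + idx n c P H)) (P %/ NP).+1 ->
  files h n c (table A (fupd M (A + idx n c P H) v)) (fun P' H' => L P' H' \/ P' = P /\ H' = H).
Proof.
move=> fL Pc HB ->; apply: (files_write n_gt0 c_gt0 fL Pc HB) => j jZ.
by rewrite /table fupdE eqn_add2l; case: eqP => // ->.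
Qed.

Definition stored x P H t P' H' :=
  P' = P /\ exists2 j, j < t & ~~ use n P (slot n c H j) /\ H' = setd B j H x.

Lemma tri_store R M Q sn P H A x L : consts R -> R 13 = A -> R 14 = x -> R 17 = H -> R 22 = P ->
  pows M sn -> wf n c sn P -> x < B -> H < BH -> region A ->
  files h n c (table A M) L -> L P H ->
  (forall R' M', frame 20 R R' -> outside A M M' ->
    files h n c (table A M') (fun P' H' => L P' H' \/ stored x P H h P' H') -> Q R' M') ->
  tri inp S W store_cmd (h * 29 + 3) R M Q.
Proof.
move=> cR R13 R14 R17 R22 pM wfP xB HB rA fL LPH q.
rewrite -[29]/(size (slot_code ++ replace_code ++ write_code) + 4).
apply: (tri_for_slots (I := fun j P' M' => [/\ P' = P, outside A M M' &
  files h n c (table A M') (fun P' H' => L P' H' \/ stored x P H j P' H')]) cR).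
- split=> //; apply: files_iff fL => P' H'; split; first by left.
  by case=> // -[_ []].
- move=> R' M' j jh [[S0 S1 S2 S3] [S4 S6 S7 S8 S9]] F S20 [S22 O fL'].
  apply: wps_cat; apply: (wps_slot (H := H) S6 _ S20) => [|R2 F2 R2_23]; first by rewrite F.
  apply: wps_cat; apply: (wps_replace (sn := sn) (P := P) (H := H) (j := j) (x := x)) => //;
    rewrite ?F2 //; rewrite ?F //; first exact: pows_outside rA O pM.
  move=> R3 F3; set H' := (if _ then _ else _) => R3_23.
  have H'B : H' < BH by rewrite /H'; case: ifP => // _; apply: setd_lt.
  have [Pc _] := wfP; have [f_le _] := fL'.
  apply: (wps_write (A := A) (P := P) (H := H')) => //;
    rewrite ?F3 // ?F2 //; rewrite ?F //; first by case: rA.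
    by apply: f_le; apply: idx_lt.
  move=> R4 F4; have F34 : frame 22 R' R4.
    by move=> r r22; rewrite F4 ?F3 ?F2 //; move: r22; clear; lia.
  split=> //; rewrite F4 // F3 // F2 //; split=> //.
    by apply: outside_trans O _; apply: outside_fupd; apply: idx_lt.
  apply: files_iff (files_fupd fL' Pc H'B erefl) => P1 H1; split.
    case=> [[LP|[-> [i ij ui]]]|[-> ->]]; first by left.
      by right; split=> //; exists i => //; apply: ltnW.
    (* At a useful slot the state written is [(P, H)] again, which [L] already contains. *)
    rewrite /H'; case: ifP => [_|/negbT nu]; first by left.
    by right; split=> //; exists j.
  case=> [LP|[-> [i]]]; first by left; left.
  rewrite ltnS leq_eqVlt => /orP[/eqP -> [nu ->]|ij ui].
    by right; rewrite /H' (negbTE nu).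
  by left; right; split=> //; exists i.
- by move=> R' M' F [_ O fL']; apply: q.
Qed.

(** * One layer of the table in memory *)

Section Layer.

Variables (d : seq hcard) (x : hcard).
Hypothesis vx : valid n c x.
Let sn := seen (x :: d).

Let x_div : code n x %/ n < c.
Proof. by rewrite (code_div n_gt0 c_gt0 vx); move: vx; rewrite /valid; lia. Qed.

Lemma tri_entry R M Q A A' j v L : consts R -> R 12 = A -> R 13 = A' -> R 14 = code n x ->
  R 16 = j -> R 28 = A + j -> R 29 = v -> j < Z -> 0 < v <= n -> region A -> region A' ->
  A + Z <= A' \/ A' + Z <= A ->
  pows M sn -> let P := j %% NP + v.-1 * NP in wf n c sn P ->
  files h n c (table A' M) L ->
  (forall R' M', frame 17 R R' -> outside A' (fupd M (A + j) 0) M' ->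
    files h n c (table A' M') (fun P' H' => L P' H' \/ succ h n c d x P (j %/ NP) P' H') ->
    Q R' M') ->
  tri inp S W entry_cmd (h * (h * 15 + 35) + 32) R M Q.
Proof.
move=> cR R12 R13 R14 R16 R28 R29 jZ v_le rA rA' AA' pM P wfP fL q.
have [[R0 R1 R2 R3] [R4 R6 R7 R8 R9]] := cR.
have -> : h * (h * 15 + 35) + 32 = 16 + (h * (h * 15 + 6) + 2 + (11 + (h * 29 + 3))) by clear; lia.
have [Pc _] := wfP; have PE : P = j %% NP + v.-1 * NP by [].
have xB : code n x < B by apply: code_lt.
have HB : j %/ NP < BH by rewrite ltn_divLR // mulnC.
have OA : outside A M (fupd M (A + j) 0) by apply: outside_fupd.
have pM1 : pows (fupd M (A + j) 0) sn by apply: pows_outside rA OA pM.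
apply: tri_seq; apply: (tri_ops W_gt0 inp_le); apply: wps_cat.
have PW : P <= W by apply: leq_trans (ltnW Pc) nc_W.
instr; first by case: rA => _ AZ; apply: leq_trans S_ge; apply: leq_trans AZ; rewrite ltn_add2l.
instr => v1 E1; instr => v2 E2; instr => [|v3 E3].
  by rewrite E2 subn1; apply: leq_trans PW; rewrite PE leq_addl.
have vP : v1 + v3 = P by rewrite E1 E3 E2 subn1.
instr => [|v4 E4]; first by rewrite vP.
instr => v5 E5; instr => [|v6 E6]; first by rewrite addn0; apply: leq_trans (ltnW xB) B_W.
apply: (wps_play (sn := sn) (P := P) (g := code n x)); rewrite ?fupdE //=.
- by rewrite E4 vP.
- by rewrite E6 addn0.
move=> Ra Fa Ra22; have Ra17 : Ra 17 = j %/ NP by rewrite Fa // !fupdE /=.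
have {}Fa : frame 17 R Ra by apply: frame_trans Fa; last framed.
have cRa := consts_frame Fa isT cR.
set P1 := play n sn P (code n x) in Ra22.
have wf1 : wf n c sn P1.
  exact: wf_play.
apply: tri_seq; apply: (tri_close (sn := sn) (H := j %/ NP) cRa Ra17 Ra22) => //.
set P2 := close _ _ _ _ _ _ => Rb Fb Rb22.
have wf2 : wf n c sn P2 by apply: wf_close.
have Rb17 : Rb 17 = j %/ NP by rewrite Fb.
have {}Fb : frame 17 R Rb by apply: frame_trans Fb.
have cRb := consts_frame Fb isT cR.
have [[S0 S1 S2 S3] [S4 S6 S7 S8 S9]] := cRb.
have fL1 : files h n c (table A' (fupd M (A + j) 0)) L.
  apply: (files_eq n_gt0 c_gt0) fL => i iZ; rewrite /table fupdE; case: eqP => // E.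
  by move: AA' E iZ jZ; move: Z; clear; lia.
have [f_le _] := fL1.
apply: tri_seq; apply: (tri_ops W_gt0 inp_le).
instr => [|v7 E7]; first by rewrite addn0; apply: leq_trans (ltnW HB) BH_W.
apply: (wps_write (A := A') (P := P2) (H := j %/ NP)); rewrite ?fupdE //=.
- by rewrite Fb.
- by rewrite E7 addn0.
- by case: wf2.
- by case: rA'.
- by apply: f_le; apply: idx_lt => //; case: wf2.
move=> Rc Fc; have Rc22 : Rc 22 = P2 by rewrite Fc.
have Rc17 : Rc 17 = j %/ NP by rewrite Fc.
have {}Fc : frame 17 R Rc.
  by apply: (frame_trans (m2 := 23)) Fb _ => //; apply: frame_trans Fc; last framed.
have cRc := consts_frame Fc isT cR.
have P2c : P2 < n ^ c by case: wf2.
apply: (tri_store (sn := sn) (A := A') (x := code n x) cRc _ _ Rc17 Rc22 _ wf2 xB HB rA'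
  (files_fupd fL1 P2c HB erefl)); rewrite ?Fc //.
- apply: pows_outside rA' _ pM1; apply: outside_fupd; exact: idx_lt.
- by right.
move=> Rd Md Fd Od fd; apply: q.
- by apply: frame_trans Fd.
- by apply: outside_trans Od; apply: outside_fupd; apply: idx_lt.
- apply: files_iff fd => P' H'; rewrite /succ /stored -/sn -/P1 -/P2; split.
    case=> [[LP|[-> ->]]|[-> s]]; first by left.
      by right; split=> //; left.
    by right; split=> //; right.
  case=> [LP|[-> [->|s]]]; first by left; left.
    by left; right.
  by right.
Qed.

Lemma tri_cells R M Q A A' : consts R -> R 12 = A -> R 13 = A' -> R 14 = code n x -> R 16 = Z ->
  region A -> region A' -> A + Z <= A' \/ A' + Z <= A -> pows M sn ->
  (forall j, j < Z -> M (A + j) <= n) ->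
  (forall P H, entry h n c (table A M) P H -> wf n c sn P) ->
  (forall j, j < Z -> M (A' + j) = 0) ->
  (forall R' M', frame 16 R R' -> (forall k, k < c -> M' k = M k) ->
    (forall j, j < Z -> M' (A + j) = 0) ->
    files h n c (table A' M') (fun P' H' => exists P H,
      entry h n c (table A M) P H /\ succ h n c d x P H P' H') ->
    Q R' M') ->
  tri inp S W (While 16 cell_cmd) (Z * (h * (h * 15 + 35) + 38)).+1 R M Q.
Proof.
move=> cR R12 R13 R14 R16 rA rA' AA' pM M_le wfM A'0 q.
have -> : (Z * (h * (h * 15 + 35) + 38)).+1 =
    (Z * (3 + (h * (h * 15 + 35) + 32).+1).+2).+1 by congr (_ * _).+1; clear; lia.
(* The counter runs down, so the cells already processed are those of index at least [i]. [entry]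
   refers to the initial memory, because cells are cleared once read. *)
pose L i P' H' := exists P H, [/\ entry h n c (table A M) P H, i <= idx n c P H &
  succ h n c d x P H P' H'].
apply: (tri_while W_gt0 (I := fun i R' M' => [/\ i <= Z, frame 16 R R' /\ R' 16 = i,
  forall k, k < c -> M' k = M k,
  forall j, j < Z -> M' (A + j) = if j < i then M (A + j) else 0 &
  files h n c (table A' M') (L i)])).
- move=> i R' M' [iZ [F R'16] Mk MA fL]; split; first by rewrite R'16.
  have cR' := consts_frame F isT cR; have [[S0 S1 S2 S3] [S4 S6 S7 S8 S9]] := cR'.
  have [cA AZ] := rA; have S12 : R' 12 = A by rewrite F.
  apply: tri_seq; apply: (tri_ops W_gt0 inp_le).
  instr => v1 E1; have {}E1 : v1 = i by rewrite E1 subn1.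
  have AiZ : A + i < c + 2 * Z by apply: leq_trans AZ; rewrite ltn_add2l.
  instr => [|v2 E2].
    by rewrite E1; apply: leq_trans (ltnW AiZ) _; move: cZ_W; clear; lia.
  instr => [|v3 E3]; first by rewrite E2 E1; apply: leq_trans AiZ S_ge.
  have {}E3 : v3 = M (A + i) by rewrite E3 E2 E1 MA // leqnn.
  rewrite {}E1 in E2 *; rewrite {}E2.
  set R1 := fupd _ _ _; have F1 : frame 16 R R1.
    by apply: (frame_trans (m2 := 16)) F _ => //; framed.
  have fZ := M_le i iZ.
  have other j : j < Z -> j != i -> (j < i.+1) = (j < i).
    by move=> _ /negbTE ji; rewrite ltnS leq_eqVlt ji.
  apply: tri_if; rewrite /R1 !fupdE /= => v3_0; last first.
    split; rewrite ?fupdE //; first exact: ltnW.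
    + move=> j jZ; rewrite MA //; have [->|ji] := eqVneq j i; last by rewrite other.
      by rewrite leqnn ltnn -E3.
    + apply: files_iff fL => P' H'; split=> -[P [H [e le s]]]; exists P, H.
        by split=> //; apply: ltnW.
      split=> //; rewrite ltn_neqAle le andbT; apply/eqP => E.
      by case: e => _ _; rewrite -E /table -E3 v3_0.
  have v_le : 0 < v3 <= n by rewrite lt0n v3_0 E3.
  have v_le' : 0 < table A M i <= n by rewrite /table -E3.
  have [e eI] := entry_unfile n_gt0 c_gt0 iZ v_le'.
  have uE : unfile n c (table A M) i = i %% NP + v3.-1 * NP by rewrite /unfile /table E3.
  rewrite uE in e eI.
  apply: (tri_entry (A := A) (A' := A') (j := i) (v := v3) (L := L i.+1)) => //.
  + by rewrite !fupdE /= F.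
  + by rewrite !fupdE /= F.
  + by move=> k kc; rewrite Mk ?pM.
  + exact: wfM e.
  move=> R2 M2 F2 O2 fL2.
  have M2E a : ~~ (A' <= a < A' + Z) -> M2 a = if a == A + i then 0 else M' a.
    by move=> na; rewrite O2 // fupdE.
  split; first exact: ltnW.
  + split; first exact: (frame_trans (m2 := 17)) F1 F2.
    by rewrite F2 // /R1 !fupdE.
  + move=> k kc; rewrite M2E; last by case: rA' => cA' _; move: kc cA'; clear; lia.
    by case: eqP => [|_]; [move: kc cA; clear; lia | rewrite Mk].
  + move=> j jZ; rewrite M2E; last by move: jZ AA'; move: Z; clear; lia.
    rewrite eqn_add2l; have [->|ji] := eqVneq j i; first by rewrite ltnn.
    by rewrite MA // other.
  + apply: files_iff fL2 => P' H'; split.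
      case=> [[P [H [e' le s]]]|s]; first by exists P, H; split=> //; apply: ltnW.
      by exists (i %% NP + v3.-1 * NP), (i %/ NP); split; rewrite // eI.
    case=> P [H [e' le s]]; have [E|ne] := eqVneq i (idx n c P H).
      by right; rewrite -uE E (unfile_entry e') idx_div.
    by left; exists P, H; split=> //; rewrite ltn_neqAle ne.
- move=> R' M' [_ [F R'16] Mk MA fL]; split=> //; apply: q => //.
  apply: files_iff fL => P' H'; split; first by case=> P [H [e _ s]]; exists P, H.
  by case=> P [H [e s]]; exists P, H.
- split=> //; first by move=> j ->.
  apply: files_iff (files_empty n_gt0 c_gt0 (f := table A' M) A'0) => P' H'; split=> //.
  by case=> P [H [[Pc Hh _]]]; rewrite leqNgt idx_lt.
Qed.

End Layer.

(** * From one card to the whole deck *)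

Variable deck : seq hcard.
Hypotheses (deck_size : size deck = N) (deck_ok : valid_deck n c deck).
Hypothesis inpE : inp = encode h n c deck.

Lemma nth_encode d x rest : deck = catrev d (x :: rest) ->
  nth 0 inp (4 + 2 * size d) = x.1 /\ nth 0 inp (4 + 2 * size d).+1 = x.2.
Proof.
move=> dE; pose fl (s : seq hcard) := flatten [seq [:: y.1; y.2] | y <- s].
have sz (s : seq hcard) : size (fl s) = 2 * size s.
  by elim: s => //= y s; rewrite /fl /= => ->; lia.
have E : inp = ([:: h; n; c; size deck] ++ fl (rev d)) ++ [:: x.1, x.2 & fl rest].
  by rewrite inpE /encode {2}dE catrevE map_cat flatten_cat -catA.
have szE : 4 + 2 * size d = size ([:: h; n; c; size deck] ++ fl (rev d)).
  by rewrite size_cat sz size_rev.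
by rewrite szE E !nth_cat ltnn subnn ltnNge leqnSn /= subSn // subnn.
Qed.

Lemma tri_pow R M Q b e : R 1 = 1 -> R 21 = e -> R 22 = b -> 0 < b -> b ^ e <= W ->
  (forall R', frame 20 R R' -> R' 20 = b ^ e -> Q R' M) ->
  tri inp S W pow_cmd (e * 4 + 2) R M Q.
Proof.
move=> R1 R21 R22 b0 beW q.
have -> : e * 4 + 2 = 1 + (e * 4).+1 by lia.
apply: tri_seq; apply: (tri_ops W_gt0 inp_le).
instr; first by lia.
apply: (tri_while W_gt0 (I := fun i R' M' => [/\ i <= e, frame 20 R R' /\ R' 21 = i,
  R' 22 = b, R' 20 = b ^ (e - i) & M' = M])).
- move=> i R' M' [ie [F R'21] R'22 R'20 ->]; split; first by rewrite R'21.
  apply: (tri_ops W_gt0 inp_le).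
  have jE : e - i = (e - i.+1).+1 by lia.
  have R'1 : R' 1 = 1 by rewrite F.
  have pE : b ^ (e - i.+1) * b = b ^ (e - i) by rewrite -expnSr jE.
  have p_le : b ^ (e - i) <= b ^ e by rewrite leq_pexp2l // leq_subr.
  instr => [|v1 E1]; first by lia.
  instr => v2 E2; split; rewrite ?fupdE //=; first by lia.
  + split; first by apply: (frame_trans (m2 := 20)) F _ => //; framed.
    by rewrite E2 subn1.
  + by rewrite E1.
- by move=> R' M' [_ [F R'21] R'22 R'20 ->]; split=> //; apply: q => //; rewrite R'20 subn0.
- by split; rewrite ?fupdE ?subnn //=; split=> //; framed.
Qed.

(** The addresses [A] and [A'] are existential because the two tables exchange their roles after
    each card. *)
Definition layer_inv i R M := exists d rest A A',
  [/\ deck = catrev d rest /\ size rest = i, [/\ R 10 = i, R 11 = 4 + 2 * size d, R 12 = A & R 13 = A'],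
    [/\ region A, region A' & A + Z <= A' \/ A' + Z <= A], pows M (seen d) &
    (forall j, j < Z -> M (A' + j) = 0) /\ table_ok h n c d (table A M)].

Lemma tri_layer i R M : consts R -> layer_inv i.+1 R M ->
  tri inp S W layer_cmd (Z * (h * (h * 15 + 35) + 38) + 4 * c + 24) R M
    (fun R' M' => frame 10 R R' /\ layer_inv i R' M').
Proof.
move=> cR [d [[|x rest] [A [A' [[dE]]]]]] //= [ri] [R10 R11 R12 R13] [rA rA' AA'] pM [A'0 tok].
have [[R0 R1 R2 R3] [R4 R6 R7 R8 R9]] := cR.
have vx : valid n c x.
  by move/allP: deck_ok; apply; rewrite dE catrevE mem_cat inE eqxx orbT.
have [in1 in2] := nth_encode dE.
have NE : N = size d + i.+1 by rewrite -deck_size dE catrevE size_cat size_rev /= ri.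
pose k := x.2.-1.
have kc : k < c by move: vx; rewrite /valid /k; lia.
have x1_gt0 : 0 < x.1 by move: vx; rewrite /valid; lia.
have x2_gt0 : 0 < x.2 by move: vx; rewrite /valid; lia.
have codeW : x.1.-1 + n * k <= W.
  by have := code_lt n_gt0 c_gt0 vx; rewrite /code -/k; move: W_ge; clear; lia.
have nkW : n * k <= W by apply: leq_trans codeW; rewrite leq_addl.
have kS : k < S by move: S_ge kc; clear; lia.
have ZW : Z + 0 <= W by move: W_ge; clear; lia.
have nk_le : n ^ k <= NP by rewrite leq_pexp2l //; lia.
have nkc : n * k <= B by rewrite leq_mul2l ltnW ?orbT.
apply: (@tri_leq inp S W layer_cmd _
  (8 + (k * 4 + 2 + (9 + ((Z * (h * (h * 15 + 35) + 38)).+1 + 4)))) R M).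
  have k4 : 4 * k <= 4 * c by rewrite leq_pmul2l // ltnW.
  by move: k4; set z := Z * _; clear; lia.
apply: tri_seq; apply: (tri_ops W_gt0 inp_le).
instr => v1 E1; instr => v2 E2; instr => [|v3 E3]; first by lia.
rewrite addn1 in E3.
instr => v4 E4; instr => v5 E5; instr => [|v6 E6]; first by lia.
have {}E5 : v5 = k by rewrite E5 E4 E3 in2 subn1.
have {}E2 : v2 = x.1.-1 by rewrite E2 E1 in1 subn1.
instr => [|v7 E7]; first by lia.
instr => [|v8 E8]; first by lia.
apply: tri_seq; apply: (tri_pow (b := n) (e := k)); rewrite ?fupdE //=.
- by rewrite E8 addn0.
- by rewrite E7 addn0.
- by lia.
move=> Ra Fa Ra20.
have Ra_ r : r < 10 -> Ra r = R r.
  by move=> r10; rewrite Fa ?(leq_trans r10) //; move: r r10; framed.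
have {}Fa14 : Ra 14 = x.1.-1 by rewrite Fa // !fupdE.
have Fa15 : Ra 15 = k by rewrite Fa // !fupdE.
have Fa10 : Ra 10 = i.+1 by rewrite Fa // !fupdE.
have Fa11 : Ra 11 = 4 + 2 * size (x :: d) by rewrite Fa // !fupdE /= E6 E3; lia.
have Fa12 : Ra 12 = A by rewrite Fa // !fupdE.
have Fa13 : Ra 13 = A' by rewrite Fa // !fupdE.
have cRa : consts Ra by apply: consts_frame (_ : frame 10 R Ra) _ cR.
have [[S0 S1 S2 S3] [S4 S6 S7 S8 S9]] := cRa.
apply: tri_seq; apply: (tri_ops W_gt0 inp_le).
instr => w1 F1.
have w1b : w1 * n ^ k <= n ^ k by rewrite F1; case: eqP; rewrite ?mul1n.
instr => [|w2 F2]; first exact: leq_trans w1b (leq_trans nk_le NP_W).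
instr => [|w3 F3]; first exact: kS.
rewrite pM // in F3.
have w3b : w3 <= n ^ k by rewrite F3; case: (seen _ _); rewrite ?mul1n.
have w23 : w2 - w3 + w3 = maxn w3 w2 by rewrite maxnE addnC.
instr => w4 F4; rewrite -F4 in w23; instr => [|w5 F5].
  by rewrite w23 geq_max; apply/andP; split; [move: w3b|move: w1b; rewrite -F2] => le;
    apply: leq_trans le (leq_trans nk_le NP_W).
(* Both the old mark and the new contribution are 0 or n^k, so their maximum is the disjunction of
   the two flags. *)
have {}F5 : w5 = seen (x :: d) k * n ^ k.
  rewrite F5 w23 F3 F2 F1 seen_cons // eqxx andbT (_ : (x.1.-1 == 0) = (x.1 == 1)).
    by case: (x.1 == 1); case: (seen d k); rewrite ?mul1n ?mul0n ?maxnn ?max0n ?maxn0.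
  by move: x1_gt0; case: (x.1).
instr; first exact: kS.
instr => [|w6 F6]; first exact: nkW.
instr => [|w7 F7]; first by rewrite F6.
instr => [|w8 F8]; first exact: ZW.
set M1 := fupd M k w5.
have M1E a : a != k -> M1 a = M a by rewrite /M1 fupdE => /negbTE->.
have pM1 : pows M1 (seen (x :: d)).
  move=> k' k'c; rewrite /M1 fupdE; case: eqP => [->|/eqP kk]; first exact: F5.
  by rewrite pM // seen_cons // (negbTE kk) andbF.
have tok1 : table_ok h n c d (table A M1).
  apply: (table_ok_eq n_gt0 c_gt0 _ tok) => j jZ; rewrite /table M1E //.
  by case: rA => cA _; move: cA kc; clear; lia.
have [tn tent _] := tok1.
apply: tri_seq; apply: (tri_cells (d := d) vx (A := A) (A' := A')); rewrite ?fupdE //=.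
- by rewrite F7 F6.
- by rewrite F8 addn0.
(* Seeing more colors only weakens [wf], so the table built for [d] can be read with the marks of
   [x :: d]. *)
- move=> P H /tent [[Pc P0] _ _ _]; split=> // k' k'c nk'; apply: P0 => //.
  by apply: contra nk'; rewrite /seen in_cons => ->; rewrite orbT.
- by move=> j jZ; rewrite M1E ?A'0 //; case: rA' => cA' _; move: cA' kc; clear; lia.
move=> Rb Mb Fb Mbk MbA fb.
have Rb_ r : r < 14 -> Rb r = Ra r.
  by move=> r14; rewrite Fb ?(leq_trans r14) //; move: r r14; framed.
have cRb : consts Rb by apply: consts_frame (_ : frame 14 Ra Rb) _ cRa.
have [[T0 T1 T2 T3] [T4 T6 T7 T8 T9]] := cRb.
have [cA AZ] := rA; have [cA' A'Z] := rA'.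
have Rb12 : Rb 12 = A by rewrite Rb_. 
have Rb13 : Rb 13 = A' by rewrite Rb_.
have Rb10 : Rb 10 = i.+1 by rewrite Rb_.
have Rb11 : Rb 11 = 4 + 2 * size (x :: d) by rewrite Rb_.
apply: (tri_ops W_gt0 inp_le).
have AW : A <= W by move: AZ W_ge; clear; lia.
have A'W : A' <= W by move: A'Z W_ge; clear; lia.
instr => [|u1 G1]; first by rewrite addn0.
instr => [|u2 G2]; first by rewrite addn0.
instr => [|u3 G3]; first by rewrite addn0 G1 addn0.
have FRb : frame 10 R Rb by move=> r r10; rewrite Rb_ ?Ra_ // (leq_trans r10).
instr => u4 G4; split; first by apply: (frame_trans (m2 := 10)) FRb _ => //; framed.
exists (x :: d), rest, A', A; split=> //.
- by split; rewrite !fupdE //= ?G4 ?G3 ?G2 ?G1 ?addn0 ?subn1.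
- by split=> //; case: AA'; [right|left].
- by move=> k' k'c; rewrite Mbk // pM1.
- split=> //; exact: (table_ok_step n_gt0 c_gt0 vx tok1 fb).
Qed.

Lemma tri_final R M Q A sn : consts R -> R 12 = A -> region A -> pows M sn ->
  (forall R', (R' 0 <> 0 <->
      (exists2 H, H < BH & M (A + (NP.-1 + NP * H)) = n) /\ (forall k, k < c -> sn k)) ->
    Q R' M) ->
  tri inp S W final_cmd (BH * 7 + c * 6 + 8) R M Q.
Proof.
move=> cR R12 [cA AZ] pM q; have [[R0 R1 R2 R3] [R4 R6 R7 R8 R9]] := cR.
have -> : BH * 7 + c * 6 + 8 = 4 + ((BH * 7).+1 + (1 + ((c * 6).+1 + 1))) by lia.
have addr_lt H : H < BH -> NP.-1 + NP * H < Z.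
  by move=> HB; move: NP_gt0 HB; clear; case: NP => // m; move: BH => b; nia.
have addr_le H : H <= BH -> A + (NP.-1 + NP * H) <= W.
  move=> HB; have : NP * H <= Z by rewrite leq_mul2l HB orbT.
  by move: AZ NP_le W_ge; clear; lia.
apply: tri_seq; apply: (tri_ops W_gt0 inp_le).
instr => //; instr => [|v1 E1]; first by rewrite addn0.
instr => v2 E2; instr => [|v3 E3].
  by have := addr_le 0 isT; rewrite E2 muln0 addn0 subn1 addnC.
have {}E3 : v3 = A + (NP.-1 + NP * 0) by rewrite E3 E2 muln0 addn0 subn1 addnC.
set M_full := fun b => exists2 H, H < b & M (A + (NP.-1 + NP * H)) = n.
apply: tri_seq; apply: (tri_while W_gt0 (I := fun i R' M' => [/\ i <= BH,
  [/\ frame 19 R R', R' 21 = i & R' 22 = A + (NP.-1 + NP * (BH - i))], R' 19 <= BH - i,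
  R' 19 <> 0 <-> M_full (BH - i) & M' = M])).
- move=> i R' M' [iB [F R'21 R'22] R'19 sig ->]; split; first by rewrite R'21.
  have [[S0 S1 S2 S3] [S4 S6 S7 S8 S9]] := consts_frame F isT cR.
  have jlt : BH - i.+1 < BH by move: iB; clear; lia.
  have jE : BH - i = (BH - i.+1).+1 by move: iB; clear; lia.
  have jE1 : BH - i = BH - i.+1 + 1 by rewrite addn1.
  have nxt : A + (NP.-1 + NP * (BH - i.+1)) + NP = A + (NP.-1 + NP * (BH - i)).
    by rewrite jE mulnS; clear; lia.
  apply: (tri_ops W_gt0 inp_le).
  instr => [|w1 F1].
    by have := addr_lt _ jlt; move: AZ S_ge; clear; lia.
  instr => w2 F2; instr => [|w3 F3].
    apply: leq_trans BH_W; apply: leq_trans (leq_subr i _); rewrite jE1.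
    by apply: leq_add R'19 _; rewrite F2; case: eqP.
  instr => [|w4 F4]; first by rewrite nxt; apply: addr_le; apply: leq_subr.
  instr => w5 F5; split; rewrite ?fupdE //=.
  + exact: ltnW.
  + split; first by apply: (frame_trans (m2 := 19)) F _ => //; framed.
      by rewrite F5 subn1.
    by rewrite F4 nxt.
  + by rewrite F3 jE1; apply: leq_add R'19 _; rewrite F2; case: eqP.
  + rewrite F3 F2 F1 jE; split.
      move=> ne; have [s0|/eqP s0] := eqVneq (R' 19) 0.
        have [E|E] := eqVneq (M (A + (NP.-1 + NP * (BH - i.+1)))) n; last first.
          by move: ne; rewrite s0 (negbTE E).
        by exists (BH - i.+1).
      by have [H Hlt E] := sig.1 s0; exists H => //; apply: ltnW.
    case=> H; rewrite ltnS leq_eqVlt => /orP[/eqP-> ->|Hlt E].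
      by rewrite eqxx addn1.
    by have : R' 19 <> 0 by [apply/sig; exists H]; case: (R' 19).
- move=> R' M' [_ [F R'21 _] R'19 sig ->]; split=> //.
  rewrite subn0 in R'19 sig.
  have [[S0 S1 S2 S3] [S4 S6 S7 S8 S9]] := consts_frame F isT cR.
  apply: tri_seq; apply: (tri_ops W_gt0 inp_le).
  instr => [|w1 F1]; first by rewrite addn0.
  apply: tri_seq; apply: (tri_while W_gt0 (I := fun i R2 M2 => [/\ i <= c,
    frame 19 R R2 /\ R2 21 = i, R2 19 <= BH,
    R2 19 <> 0 <-> M_full BH /\ (forall k, i <= k < c -> sn k) & M2 = M])).
  + move=> i R2_ M2 [ic [F2 R2_21] R2_19 sig2 ->]; split; first by rewrite R2_21.
    have [[T0 T1 T2 T3] [T4 T6 T7 T8 T9]] := consts_frame F2 isT cR.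
    apply: (tri_ops W_gt0 inp_le).
    instr => w2 G2; rewrite subn1 /= in G2; rewrite {}G2.
    instr => [|w3 G3]; first exact: leq_trans ic c_S.
    instr => w4 G4.
    have m_le : R2_ 19 * w4 <= BH.
      by rewrite G4; case: (0 < w3); rewrite ?muln1 ?muln0.
    instr => [|w5 G5]; first exact: leq_trans m_le BH_W.
    have w3E : (0 < w3) = sn i.
      by rewrite G3 pM //; case: (sn i); rewrite ?mul1n ?mul0n // expn_gt0 n_gt0.
    split; rewrite ?fupdE //=.
    * exact: ltnW.
    * by split=> //; apply: (frame_trans (m2 := 19)) F2 _ => //; framed.
    * by rewrite G5.
    * rewrite G5 G4 w3E; case s: (sn i); rewrite ?muln1 ?muln0.
        rewrite sig2; split=> -[fl al]; split=> // k.
          by rewrite leq_eqVlt => /andP[/orP[/eqP<- //|ik] kc]; apply: al; rewrite ik.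
        by move=> /andP[ik kc]; apply: al; rewrite kc ltnW.
      split=> // -[_ al]; have := al i; rewrite leqnn ic s.
      by move=> /(_ isT).
  + move=> R2_ M2 [_ [F2 R2_21] R2_19 sig2 ->]; split=> //.
    have [[T0 T1 T2 T3] _] := consts_frame F2 isT cR.
    apply: (tri_ops W_gt0 inp_le).
    instr => [|w5 G5]; first by rewrite addn0; apply: leq_trans BH_W.
    apply: q; rewrite fupdE /= G5 addn0 sig2.
    by split=> -[fl al]; split.
  + split; rewrite ?fupdE //=.
    * by rewrite F1 addn0; split=> //; apply: (frame_trans (m2 := 19)) F _ => //; framed.
    * rewrite sig; split=> [fl|[]//]; split=> // k /andP[ck kc].
      by move: kc; rewrite ltnNge ck.
- split; rewrite ?fupdE ?subnn //=.
  + by rewrite E1 E3 addn0; split=> //; framed.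
  + by split=> // -[H].
Qed.

Lemma tri_hanabi R M Q : 0 < N -> (forall r, R r = 0) -> (forall a, M a = 0) ->
  (forall R' M', (R' 0 <> 0 <-> winnable h n c deck) -> Q R' M') ->
  tri inp S W hanabi_cmd
    (N * (Z * (h * (h * 15 + 35) + 38) + 4 * c + 26) + BH * 7 + c * 10 + h * 4 + 40) R M Q.
Proof.
move=> N0 R0 M0 q.
apply: (@tri_leq inp S W hanabi_cmd _ (3 + (8 + (h * 4 + 2 + (3 + (c.-1 * 4 + 2 + (5 +
  ((N * (Z * (h * (h * 15 + 35) + 38) + 4 * c + 24).+2).+1 + (BH * 7 + c * 6 + 8))))))).+1) R M).
  have -> : (Z * (h * (h * 15 + 35) + 38) + 4 * c + 24).+2 =
      Z * (h * (h * 15 + 35) + 38) + 4 * c + 26 by rewrite !addnS.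
  by set z := N * _; move: (leq_pred c); clear; lia.
have cZW : c + Z <= W by move: W_ge; clear; lia.
have W6 : 6 <= W by move: W_ge; clear; lia.
have cS : c < S by move: S_ge Z_gt0; clear; lia.
apply: tri_seq; apply: (tri_ops W_gt0 inp_le).
instr; first by apply: leq_trans W6.
instr; first by apply: leq_trans W6.
instr => w1 E1; have {}E1 : w1 = N by rewrite E1 inpE /= deck_size.
apply: tri_if; rewrite fupdE /=; last by rewrite E1 => E; rewrite E in N0.
move=> _; apply: tri_seq; apply: (tri_ops W_gt0 inp_le).
instr => w2 E2; have {}E2 : w2 = h by rewrite E2 ?fupdE /= R0 inpE.
instr => w3 E3; have {}E3 : w3 = n by rewrite E3 inpE.
instr; first by apply: leq_trans W6.
instr => w4 E4; have {}E4 : w4 = c by rewrite E4 inpE.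
instr; first by apply: leq_trans W6.
instr => [|w5 E5]; first by rewrite E3 E4.
instr => [|w6 E6]; first by rewrite E5 E3 E4 ?fupdE /= R0 addn0.
instr => [|w7 E7]; first by rewrite E2 ?fupdE /= R0 addn0.
apply: tri_seq; apply: (tri_pow (b := B) (e := h)); rewrite ?fupdE //=.
- by rewrite E7 E2 ?fupdE /= R0 addn0.
- by rewrite E6 E5 E3 E4 ?fupdE /= R0 addn0.
move=> Ra Fa Ra20; apply: tri_seq; apply: (tri_ops W_gt0 inp_le).
have Ra0 : Ra 0 = 0 by rewrite Fa // !fupdE /=.
have Ra1 : Ra 1 = 1 by rewrite Fa // !fupdE /=.
have Ra2 : Ra 2 = h by rewrite Fa // !fupdE /=.
have Ra3 : Ra 3 = n by rewrite Fa // !fupdE /=.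
have Ra4 : Ra 4 = c by rewrite Fa // !fupdE /=.
have Ra6 : Ra 6 = B by rewrite Fa // !fupdE /= E5 E3 E4.
have Ra10 : Ra 10 = N by rewrite Fa // !fupdE /=.
have Ra11 : Ra 11 = 4 by rewrite Fa // !fupdE /=.
instr => [|w8 E8]; first by rewrite addn0.
instr => [|w9 E9]; first by rewrite addn0.
instr => w10 E10; apply: tri_seq; apply: (tri_pow (b := n) (e := c.-1)); rewrite ?fupdE //=.
- by rewrite E10 subn1.
- by rewrite E9 addn0.
move=> Rb Fb Rb20; apply: tri_seq; apply: (tri_ops W_gt0 inp_le).
have Rb0 : Rb 0 = 0 by rewrite Fb // !fupdE /=.
have Rb1 : Rb 1 = 1 by rewrite Fb // !fupdE /=.
have Rb2 : Rb 2 = h by rewrite Fb // !fupdE /=.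
have Rb3 : Rb 3 = n by rewrite Fb // !fupdE /=.
have Rb4 : Rb 4 = c by rewrite Fb // !fupdE /=.
have Rb6 : Rb 6 = B by rewrite Fb // !fupdE /=.
have Rb7 : Rb 7 = BH by rewrite Fb // !fupdE /= E8 addn0.
have Rb10 : Rb 10 = N by rewrite Fb // !fupdE /=.
have Rb11 : Rb 11 = 4 by rewrite Fb // !fupdE /=.
have ZW : Z <= W by apply: leq_trans cZW; apply: leq_addl.
instr => [|w11 E11]; first by rewrite addn0.
rewrite addn0 in E11.
instr => [|w12 E12]; first by rewrite E11.
rewrite E11 in E12.
instr => [|w13 E13]; first by rewrite addn0.
rewrite addn0 in E13.
instr => [|w14 E14]; first by rewrite E13 E12.
rewrite E13 E12 in E14.
instr; first by rewrite E13.
rewrite E13; apply: tri_seq.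
apply: (tri_while W_gt0 (I := fun i R' M' => consts R' /\ layer_inv i R' M')).
- move=> i R' M' [cR' L]; split.
    by have [d [rest [A [A' [_ [R'10 _ _ _] _ _ _]]]]] := L; rewrite R'10.
  move=> b P o C; have [t [R2 [M2 [tt r b2 [F2 L2]]]]] := tri_layer cR' L b C.
  by exists t, R2, M2; split=> //; split=> //; apply: consts_frame F2 isT cR'.
- move=> R' M' [cR' [d [rest [A [A' []]]]]].
  move=> [dE /size0nil rE] [R'10 R'11 R'12 R'13] [rA rA' AA'] pM [_ tok].
  split=> //; apply: (tri_final cR' R'12 rA pM) => R2 sol; apply: q; rewrite sol.
  have d_rev : d = rev deck by rewrite dE rE catrevE cats0 revK.
  by rewrite d_rev in tok *; rewrite (winnable_table n_gt0 c_gt0 tok).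
- split; first by split; split; rewrite !fupdE.
  (* The tables start after the c marks. The only nonempty cell, at address c, contains 1: the empty
     hand with last digit 0. *)
  exists [::], deck, c, (c + Z); split=> //.
  + rewrite /region; split; last by left.
      by split=> //; clear; lia.
    by split; clear; lia.
  + by move=> k kc; rewrite fupdE M0; case: eqP kc => // ->; rewrite ltnn.
  + split=> [j jZ|].
      rewrite fupdE M0; case: eqP => // E; move: Z_gt0 E; clear; lia.
    apply: (table_ok_init n_gt0 c_gt0) => j jZ; rewrite /table fupdE M0.
    have -> : (c + j == c) = (j == 0) by rewrite -{2}[c]addn0 eqn_add2l.
    by case: (j == 0).
Qed.

End Correct.

(** * Halting and resource bounds *)

Lemma code_at_self P : code_at P 0 P.
Proof. by move=> i; rewrite add0n. Qed.

Lemma tri_halts inp S W k T R M Q : 0 < W -> bounded W R M -> tri inp S W k T R M Q ->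
  within (compile 0 k) inp T S W (MSt 0 R M) /\
  exists sf, exec (compile 0 k) inp T (MSt 0 R M) = Some sf /\ Q (reg sf) (Defs.mem sf).
Proof.
move=> W0 b T_k; have [t [R' [M' [tT r b' q]]]] := T_k b _ 0 (@code_at_self _).
(* Compiled code ends by running past its last instruction, not by an [IHalt]. *)
have halted : step (compile 0 k) inp (MSt (0 + csize k) R' M') = None.
  by rewrite /step /= size_compile ltnn.
have [w e] := runs_halt r halted tT.
by split=> //; exists (MSt (0 + csize k) R' M').
Qed.

Lemma tri_empty inp S W R M Q : 3 <= W -> (forall i, nth 0 inp i <= W) -> nth 0 inp 3 = 0 ->
  (forall r, R r = 0) -> (forall R' M', R' 0 = 0 -> Q R' M') -> tri inp S W hanabi_cmd 130 R M Q.
Proof.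
move=> W3 inp_le i3 R0 q; have W0 : 0 < W by apply: leq_trans W3.
(* Three instructions and one test are executed; 126 is the slack that fills up the constant 130. *)
apply: (@tri_leq inp S W hanabi_cmd _ (3 + 126.+1) R M) => //.
apply: tri_seq; apply: (tri_ops W0 inp_le).
instr; first exact: W0.
instr; first exact: W3.
instr => w E; apply: tri_if; rewrite !fupdE /= => E'; first by rewrite E i3 in E'.
by apply: q; rewrite ?fupdE /= R0.
Qed.

Lemma not_winnable_nil h n c : 0 < n -> 0 < c -> ~ winnable h n c [::].
Proof.
by move=> n0 c0 [p [H [[pE _] W]]]; have := W 1; rewrite c0 pE => /(_ isT) E; rewrite -E in n0.
Qed.

Theorem theorem2 :
  exists (P : seq instr) (C K : nat),
    forall (h n c : nat) (deck : seq hcard),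
      0 < h -> 0 < n -> 0 < c -> valid_deck n c deck ->
      let inp := encode h n c deck in
      let T := C * time_bound (size deck) n c h + C in
      let S := C * space_bound n c h + C in
      let W := (T + size inp + \max_(i <- inp) i + 2) ^ K in
      within P inp T S W init_state /\
      exists sf, exec P inp T init_state = Some sf /\
                 (reg sf 0 <> 0 <-> winnable h n c deck).
Proof.
(* The largest words are of order [n * c * (n * c) ^ h], at most X^3; the fourth factor X, which is
   at least 130, absorbs the constants. For the time, 130 exceeds 71 + 7 + 10 + 4, the multiples of
   [E] spent on the layers, the final scan, and the terms in c and h. *)
exists (compile 0 hanabi_cmd), 130, 4 => h n c deck h0 n0 c0 deck_ok inp T S W.
pose X := T + size inp + \max_(i <- inp) i + 2; have WE : W = X ^ 4 by [].
have X2 : 2 <= X by rewrite leq_addl.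
have XW k : k <= 4 -> X ^ k <= W by move=> k4; rewrite WE leq_pexp2l // ltnW.
have inp_le i : nth 0 inp i <= X.
  have [lt|ge] := ltnP i (size inp); last by rewrite nth_default.
  have : nth 0 inp i <= \max_(i <- inp) i by apply: leq_bigmax_seq => //; apply: mem_nth.
  by rewrite /X; clear; lia.
have inpW i : nth 0 inp i <= W by apply: leq_trans (XW 1 isT).
have W0 : 0 < W by rewrite WE expn_gt0 (leq_trans _ X2).
have W3 : 3 <= W by apply: leq_trans (XW 2 isT); apply: leq_trans (leq_mul X2 X2).
have b0 : bounded W (fun=> 0) (fun=> 0) by split.
apply: (tri_halts (Q := fun R' _ => R' 0 <> 0 <-> winnable h n c deck)) => //.
have [N0|Npos] := posnP (size deck).
  have -> : T = 130 by rewrite /T /time_bound N0 !mul0n muln0.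
  apply: tri_empty => // R' _ ->; split=> // w.
  by case: (not_winnable_nil n0 c0 (h := h)); rewrite (size0nil N0) in w.
have SE : space_bound n c h = n ^ c.-1 * (n * c) ^ h.
  rewrite /space_bound expnMn mulnA -expnD mulnC; congr (n ^ _ * _); lia.
set Z := n ^ c.-1 * (n * c) ^ h in SE.
have Z_gt0 : 0 < Z by rewrite muln_gt0 !expn_gt0 muln_gt0 n0 c0.
have cZ : c <= Z.
  rewrite -SE; apply: leq_trans (leq_pmulr _ _); last by rewrite expn_gt0 n0.
  by rewrite -[X in X <= _]expn1 leq_pexp2l.
have BHZ : (n * c) ^ h <= Z by rewrite leq_pmull // expn_gt0 n0.
have NPZ : n ^ c.-1 <= Z by rewrite leq_pmulr // expn_gt0 muln_gt0 n0 c0.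
have TE : T = 130 * (size deck * (h ^ 2 + h * c) * Z) + 130.
  by rewrite /T /time_bound -!mulnA -/(space_bound n c h) SE.
set D := h ^ 2 + h * c in TE; set E := size deck * D * Z in TE.
have DE : D = h * h + h * c by rewrite /D expnS expn1.
have hD : h * h + h <= D by rewrite DE leq_add2l leq_pmulr.
have D2 : 2 <= D by apply: leq_trans hD; rewrite -[2]/(1 * 1 + 1) leq_add ?leq_mul.
have D0 : 0 < D by apply: leq_trans hD; rewrite addn_gt0 h0 orbT.
have cD : c <= D by rewrite DE (leq_trans (leq_pmull c h0)) ?leq_addl.
have ZE : Z <= E by rewrite leq_pmull // muln_gt0 Npos D0.
have NE : size deck <= E by rewrite /E -mulnA leq_pmulr // muln_gt0 Z_gt0 D0.
have hE : h <= E.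
  apply: (@leq_trans D); first by apply: leq_trans hD; apply: leq_addl.
  by rewrite /E mulnAC leq_pmull // muln_gt0 Npos.
have TX : T <= X by do 3 apply: leq_trans (leq_addr _ _).
have nX : n <= X by apply: inp_le 1.
apply: tri_leq (tri_hanabi h0 n0 c0 (N := size deck) _ _ inpW erefl deck_ok erefl Npos _ _ _) => //.
(* 54 = 35 + 19, from [h * h + h <= D] and [2 <= D]; below, 17 = 4 + 13 from [c <= D] and [2 <= D],
   and 71 = 54 + 17. *)
- have tZ : Z * (h * (h * 15 + 35) + 38) <= 54 * (D * Z).
    rewrite [D * Z]mulnC mulnCA leq_mul2l; apply/orP; right.
    have -> : h * (h * 15 + 35) = 15 * (h * h) + 35 * h by clear; lia.
    by move: hD D2; clear; lia.
  have tD : 4 * c + 26 <= 17 * (D * Z).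
    apply: (@leq_trans (17 * D)); first by move: cD D2; clear; lia.
    by rewrite leq_mul2l leq_pmulr ?orbT.
  have tN : size deck * (Z * (h * (h * 15 + 35) + 38) + 4 * c + 26) <= 71 * E.
    by rewrite /E -mulnA mulnCA leq_mul2l; apply/orP; right; move: tZ tD; rewrite mulnDr; clear; lia.
  by rewrite TE; move: tN BHZ ZE cZ hE; clear; lia.
- have X3 : X ^ 3 = X * X * X by rewrite !expnS expn0 muln1 mulnA.
  have big : 130 * X ^ 3 <= W.
    by rewrite WE (expnS _ 3) leq_mul2r; apply/orP; right; move: ZE TX Z_gt0; rewrite TE; clear; lia.
  have nc : n ^ c <= X * X.
    rewrite -[c]prednK // expnS leq_mul //; apply: leq_trans NPZ _.
    by move: ZE TX; rewrite TE; clear; lia.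
  have cX : c <= X by move: cZ ZE TX; rewrite TE; clear; lia.
  have ncX : n * c <= X * X by rewrite leq_mul.
  have ncBH : n * c * (n * c) ^ h <= X * X * X.
    by rewrite leq_mul //; move: BHZ ZE TX; rewrite TE; clear; lia.
  have XX : X <= X * X by rewrite leq_pmulr // ltnW.
  have XXX : X * X <= X * X * X by rewrite leq_pmulr // ltnW.
  have small : 4 * Z + n + c + h + 2 * size deck + 6 <= 9 * X.
    by move: nX cX ZE NE hE TX; rewrite TE; clear; lia.
  by move: small big nc ncX ncBH XX XXX; rewrite X3; clear; lia.
- by rewrite /S SE; move: cZ; clear; lia.
Qed.
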